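(* Let $N\ge 1$ be an integer, let $[a,b]$ be a finite segment, let $p,q,r_1,\dots,r_N$ be complex-valued functions of the real variable $x\in[a,b]$, and let $\lambda\in\mathbb{C}$. Suppose that on $[a,b]$ the equation $$(pv')'+qv=0$$ possesses a particular non-vanishing solution $u_0$ such that the functions $u_0^2r_k$, $k=1,\dots,N$, and $\frac{1}{u_0^2p}$ are continuous on $[a,b]$. Let $x_0$ be an arbitrary point of $[a,b]$ such that $p(x_0)\neq 0$. Define functions $\widetilde X^{(n)}$ and $X^{(n)}$ on $[a,b]$, $n\in\mathbb{Z}$, by $$\widetilde X^{(n)}\equiv X^{(n)}\equiv 0\ \text{ for } n<0,\qquad \widetilde X^{(0)}\equiv X^{(0)}\equiv 1,$$ and, for $n\ge 1$, $$\widetilde X^{(n)}(x)=\begin{cases}\displaystyle\int_{x_0}^{x}u_0^2(y)\sum_{k=1}^{N}\widetilde X^{(n-2k+1)}(y)\,r_k(y)\,dy, & n \text{ odd},\\[2mm] \displaystyle\int_{x_0}^{x}\widetilde X^{(n-1)}(y)\frac{1}{u_0^2(y)p(y)}\,dy, & n\text{ even},\end{cases}$$ $$X^{(n)}(x)=\begin{cases}\displaystyle\int_{x_0}^{x}X^{(n-1)}(y)\frac{1}{u_0^2(y)p(y)}\,dy, & n \text{ odd},\\[2mm] \displaystyle\int_{x_0}^{x}u_0^2(y)\sum_{k=1}^{N}X^{(n-2k+1)}(y)\,r_k(y)\,dy, & n\text{ even}.\end{cases}$$ Then a general solution on $[a,b]$ of the equation $$(pu')'+qu=u\sum_{k=1}^{N}\lambda^k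 r_k$$ has the form $u=c_1u_1+c_2u_2$, where $c_1$ and $c_2$ are arbitrary complex constants and $$u_1=u_0\sum_{n=0}^{\infty}\lambda^n\widetilde X^{(2n)},\qquad u_2=u_0\sum_{n=0}^{\infty}\lambda^n X^{(2n+1)}.$$ Moreover, both series $\sum_{n=0}^{\infty}\lambda^n\widetilde X^{(2n)}$ and $\sum_{n=0}^{\infty}\lambda^n X^{(2n+1)}$ converge uniformly on $[a,b]$.
   Context: Solutions are complex-valued functions understood in the classical sense ($u$ and $pu'$ are differentiable on the segment and the equation holds pointwise). ''General solution has the form $c_1u_1+c_2u_2$'' means that $u_1,u_2$ are linearly independent solutions and that the set of all solutions is exactly $\{c_1u_1+c_2u_2 : c_1,c_2\in\mathbb{C}\}$. The convention $\lambda^0=1$ is used also for $\lambda=0$. ''Non-vanishing'' means having no zero on the segment. *)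

(* Defs.v *)
From Stdlib Require Import Reals ZArith.
From Coquelicot Require Import Coquelicot.
Open Scope C_scope.

Definition Icc (a b : R) (x : R) : Prop := (a <= x <= b)%R.

(* The derivative at [x] of a function on the segment [a, b], one-sided at the
   end points. This is [is_derive] with [locally x] restricted to [a, b]; the
   limit is unique when [a < b]. The values of [f] outside [a, b] play no role. *)
Definition is_derive_on (a b : R) (f : R -> C) (x : R) (l : C) : Prop :=
  filterdiff (U := R_NormedModule) (V := C_R_NormedModule)
    f (within (Icc a b) (locally x)) (fun h : R => scal (V := C_R_NormedModule) h l).

Definition C_RInt (f : R -> C) (a b : R) : C :=
  RInt (V := C_R_CompleteNormedModule) f a b.

(* Total, like [Series] and [RInt]: meaningful when the series converges. *)
Definition C_Series (s : nat -> C) : C :=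
  iota (T := C_CompleteNormedModule) (is_series (V := C_NormedModule) s).

Definition series_cvu_on (a b : R) (f : nat -> R -> C) : Prop :=
  forall eps : posreal, exists M : nat, forall (n : nat) (x : R),
    (M <= n)%nat -> Icc a b x ->
    (Cmod (sum_n (fun k => f k x) n - C_Series (fun k => f k x)) < eps)%R.

(* (p u')' + q u = f holds classically on [a, b]. *)
Definition sturm_liouville_eq
    (a b : R) (p q u f : R -> C) : Prop :=
  exists du dpdu : R -> C, forall x : R, Icc a b x ->
    is_derive_on a b u x (du x) /\
    is_derive_on a b (fun y => p y * du y) x (dpdu x) /\
    dpdu x + q x * u x = f x.

(* The sum of lambda^k r_k(x) for k = 1, ..., N; the family [r] is used only at
   the indices 1, ..., N. *)
Definition pencil (N : nat) (lambda : C) (r : nat -> R -> C) (x : R) : C :=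
  sum_n_m (fun k => lambda ^ k * r k x) 1 N.

Definition pencil_solution (N : nat) (a b : R) (p q : R -> C)
    (r : nat -> R -> C) (lambda : C) (u : R -> C) : Prop :=
  sturm_liouville_eq a b p q u (fun x => u x * pencil N lambda r x).

Definition linearly_independent_on (a b : R) (u1 u2 : R -> C) : Prop :=
  forall c1 c2 : C,
    (forall x, Icc a b x -> c1 * u1 x + c2 * u2 x = 0) -> c1 = 0 /\ c2 = 0.

(* Functions on [a, b] are total functions on [R] considered up to their values
   outside [a, b], hence the pointwise equality on [a, b]. *)
Definition general_solution_on (a b : R) (is_sol : (R -> C) -> Prop)
    (u1 u2 : R -> C) : Prop :=
  is_sol u1 /\ is_sol u2 /\ linearly_independent_on a b u1 u2 /\
  forall u : R -> C,
    is_sol u <->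
    exists c1 c2 : C, forall x, Icc a b x -> u x = c1 * u1 x + c2 * u2 x.

(* The recursive definition of the two families of formal powers. *)
Record formal_powers (N : nat) (a b : R) (p : R -> C) (r : nat -> R -> C)
    (u0 : R -> C) (x0 : R) (Xt X : Z -> R -> C) : Prop := {
  Xt_neg : forall n x, (n < 0)%Z -> Icc a b x -> Xt n x = 0;
  X_neg : forall n x, (n < 0)%Z -> Icc a b x -> X n x = 0;
  Xt_0 : forall x, Icc a b x -> Xt 0%Z x = 1;
  X_0 : forall x, Icc a b x -> X 0%Z x = 1;
  Xt_odd : forall n x, (1 <= n)%Z -> Z.Odd n -> Icc a b x ->
    Xt n x = C_RInt (fun y => u0 y ^ 2 *
      sum_n_m (fun k => Xt (n - 2 * Z.of_nat k + 1)%Z y * r k y) 1 N) x0 x;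
  Xt_even : forall n x, (1 <= n)%Z -> Z.Even n -> Icc a b x ->
    Xt n x = C_RInt (fun y => Xt (n - 1)%Z y * (1 / (u0 y ^ 2 * p y))) x0 x;
  X_odd : forall n x, (1 <= n)%Z -> Z.Odd n -> Icc a b x ->
    X n x = C_RInt (fun y => X (n - 1)%Z y * (1 / (u0 y ^ 2 * p y))) x0 x;
  X_even : forall n x, (1 <= n)%Z -> Z.Even n -> Icc a b x ->
    X n x = C_RInt (fun y => u0 y ^ 2 *
      sum_n_m (fun k => X (n - 2 * Z.of_nat k + 1)%Z y * r k y) 1 N) x0 x
}.

(* Main.v *)
Require Import Defs.
From Stdlib Require Import Reals ZArith Lra Lia FunctionalExtensionality.
From Coquelicot Require Import Coquelicot.
Open Scope C_scope.

(** The substitution [u = u0 * v] and the Wronskian [w = p * u0 ^ 2 * v'] turn the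
    equation into the first-order system [v' = P * w], [w' = Q * v], where
    [P = 1 / (u0 ^ 2 * p)] and [Q] is [u0 ^ 2] times the sum of the
    [lambda ^ k * r k]; both are continuous on the segment
    ([sturm_liouville_system]).

    The formal powers are the coefficients of the power series in [lambda] of two
    solutions of this system: [Xt] gives the one with [v x0 = 1], [w x0 = 0], and
    [X] the one with [v x0 = 0], [w x0 = 1]. Both families are instances of one
    recursion, [coupled_recursion], in which a pair of sequences is integrated
    alternately. In the sup norm weighted by [exp (- K * Rabs (x - x0))],
    integration from [x0] contracts by [1 / K] ([C_RInt_exp_bound]); for [K]
    large, induction shows that the terms, multiplied by their power of [lambda],
    are dominated by a geometric series of ratio 1/2 ([coupled_bounds]). The
    series therefore converge uniformly, and may be integrated term by term, which
    shows that their sums solve the system ([coupled_series]).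

    It remains to see that these two solutions span all the others. For two
    solutions [(v, w)], [(v', w')] of the system, [v * w' - v' * w] has zero
    derivative, hence is constant on the segment. The two special solutions have
    Wronskian 1, and Cramer's rule expresses every solution as
    [v = v x0 * v1 + w x0 * v2] ([system_general_solution]). Linear independence
    is read off from the value and the derivative at [x0], since [P x0] is not
    zero ([system_linearly_independent]). *)

(** * Continuous functions on a segment *)

Lemma norm_C_R (z : C) : norm (V := C_R_NormedModule) z = Cmod z.
Proof.
  unfold norm; simpl; unfold prod_norm, Cmod, norm; simpl; unfold abs; simpl.
  f_equal. rewrite !Rmult_1_r, <- !Rabs_mult, !Rabs_pos_eq; auto; apply Rle_0_sqr.
Qed.

(** The topology of [C] is the product one; this restates continuity with the modulus. *)
Lemma continuous_on_Cmod (a b : R) (f : R -> C) :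
  continuous_on (Icc a b) f <->
  forall x, Icc a b x -> forall eps : posreal, exists d : posreal,
    forall y, Icc a b y -> (Rabs (y - x) < d)%R -> (Cmod (f y - f x) < eps)%R.
Proof.
  split.
  - intros H x Hx eps. specialize (H x Hx).
    apply (proj1 (filterlim_locally_ball_norm (U := C_R_NormedModule) f (f x))) with (eps := eps) in H.
    destruct H as [d H]. exists d. intros y Hy Hyx.
    specialize (H y Hyx Hy). unfold ball_norm in H. rewrite norm_C_R in H. exact H.
  - intros H x Hx.
    apply (proj2 (filterlim_locally_ball_norm (U := C_R_NormedModule) f (f x))).
    intros eps. destruct (H x Hx eps) as [d Hd]. exists d. intros y Hy Hyi.
    unfold ball_norm. rewrite norm_C_R. apply Hd; assumption.
Qed.

(** The uniform structure of [C] as a product and the one coming from its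
    absolute value have the same neighbourhoods but are not convertible; limits
    transfer between them. *)
Lemma filterlim_C_AbsRing {T : Type} (F : (T -> Prop) -> Prop) (f : T -> C) (l : C) :
  filterlim f F (locally (T := C_UniformSpace) l) <->
  filterlim f F (locally (T := AbsRing_UniformSpace C_AbsRing) l).
Proof.
  split; intros H P HP; apply H; apply locally_C; exact HP.
Qed.

Lemma continuous_on_const (a b : R) (c : C) : continuous_on (Icc a b) (fun _ => c).
Proof. intros x _. apply filterlim_const. Qed.

Lemma continuous_on_plus (a b : R) (f g : R -> C) :
  continuous_on (Icc a b) f -> continuous_on (Icc a b) g ->
  continuous_on (Icc a b) (fun x => f x + g x).
Proof.
  intros Hf Hg x Hx.
  exact (filterlim_comp_2 _ _ _ (Hf x Hx) (Hg x Hx)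
    (filterlim_plus (V := C_R_NormedModule) (f x) (g x))).
Qed.

Lemma continuous_on_mult (a b : R) (f g : R -> C) :
  continuous_on (Icc a b) f -> continuous_on (Icc a b) g ->
  continuous_on (Icc a b) (fun x => f x * g x).
Proof.
  intros Hf Hg x Hx. apply filterlim_C_AbsRing.
  exact (filterlim_comp_2 _ _ _ (proj1 (filterlim_C_AbsRing _ _ _) (Hf x Hx))
    (proj1 (filterlim_C_AbsRing _ _ _) (Hg x Hx))
    (filterlim_mult (K := C_AbsRing) (f x) (g x))).
Qed.

Lemma continuous_on_equal (a b : R) (f g : R -> C) :
  (forall x, Icc a b x -> f x = g x) ->
  continuous_on (Icc a b) f -> continuous_on (Icc a b) g.
Proof.
  intros E Hf x Hx. rewrite <- (E x Hx).
  apply filterlim_within_ext with f; [apply E | apply Hf, Hx].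
Qed.

Lemma continuous_on_sum (a b : R) (f : nat -> R -> C) (N : nat) :
  (forall k, (1 <= k <= N)%nat -> continuous_on (Icc a b) (f k)) ->
  continuous_on (Icc a b) (fun x => sum_n_m (fun k => f k x) 1 N).
Proof.
  induction N as [|N IH]; intros H.
  - apply continuous_on_equal with (fun _ => 0); [|apply continuous_on_const].
    intros x _. rewrite sum_n_m_zero; [reflexivity | lia].
  - apply continuous_on_equal with (fun x => sum_n_m (fun k => f k x) 1 N + f (S N) x).
    + intros x _. rewrite sum_n_Sm; [reflexivity | lia].
    + apply continuous_on_plus; [apply IH; intros; apply H; lia | apply H; lia].
Qed.

(** The retraction of the line onto [a, b]. Composing with it turns a function
    continuous on the segment into one continuous on the whole line, to which the
    two-sided theorems on integrals apply. *)
Definition clamp (a b x : R) : R := Rmax a (Rmin b x).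

Lemma clamp_Icc (a b x : R) : (a <= b)%R -> Icc a b (clamp a b x).
Proof.
  intros H. unfold clamp, Icc. split; [apply Rmax_l|].
  apply Rmax_lub; [exact H | apply Rmin_l].
Qed.

Lemma clamp_id (a b x : R) : Icc a b x -> clamp a b x = x.
Proof.
  intros [H1 H2]. unfold clamp. rewrite Rmin_right, Rmax_right; auto.
Qed.

Lemma clamp_lipschitz (a b x y : R) : (Rabs (clamp a b y - clamp a b x) <= Rabs (y - x))%R.
Proof.
  unfold clamp, Rmax, Rmin.
  repeat destruct (Rle_dec _ _); unfold Rabs; repeat destruct (Rcase_abs _); lra.
Qed.

Lemma continuous_clamp (a b : R) (f : R -> C) (x : R) : (a <= b)%R ->
  continuous_on (Icc a b) f -> continuous (fun y => f (clamp a b y)) x.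
Proof.
  intros Hab Hf. unfold continuous.
  apply (filterlim_comp _ _ _ (clamp a b) f _ (within (Icc a b) (locally (clamp a b x)))).
  - intros P [d Hd]. exists d. intros y Hy. apply Hd.
    + apply Rle_lt_trans with (2 := Hy). apply clamp_lipschitz.
    + apply clamp_Icc, Hab.
  - apply Hf, clamp_Icc, Hab.
Qed.

Lemma continuous_on_bounded (a b : R) (f : R -> C) : (a <= b)%R ->
  continuous_on (Icc a b) f ->
  exists M : R, (0 < M)%R /\ forall x, Icc a b x -> (Cmod (f x) <= M)%R.
Proof.
  intros Hab Hf.
  destruct (bounded_continuity (V := C_R_NormedModule) (fun y => f (clamp a b y)) a b) as [M HM].
  - intros x _. apply continuous_clamp; assumption.
  - exists M. assert (H : forall x, Icc a b x -> (Cmod (f x) < M)%R).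
    { intros x Hx. specialize (HM x Hx). rewrite norm_C_R, (clamp_id a b x Hx) in HM. exact HM. }
    split; [|intros; apply Rlt_le; auto].
    apply Rle_lt_trans with (Cmod (f a)); [apply Cmod_ge_0 | apply H; split; lra].
Qed.

(** * Integrals on a segment *)

Lemma Icc_between (a b x y t : R) : Icc a b x -> Icc a b y ->
  (Rmin x y <= t <= Rmax x y)%R -> Icc a b t.
Proof.
  unfold Icc, Rmin, Rmax. intros H1 H2. destruct (Rle_dec x y); lra.
Qed.

Lemma is_RInt_clamp (a b : R) (f : R -> C) (x y : R) :
  (a <= b)%R -> continuous_on (Icc a b) f ->
  is_RInt (V := C_R_NormedModule) (fun t => f (clamp a b t)) x y
    (C_RInt (fun t => f (clamp a b t)) x y).
Proof.
  intros Hab Hf.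
  apply (RInt_correct (V := C_R_CompleteNormedModule)).
  apply (ex_RInt_continuous (V := C_R_CompleteNormedModule)). intros z _.
  apply continuous_clamp; assumption.
Qed.

Lemma C_RInt_equal (a b : R) (f g : R -> C) (x y : R) : Icc a b x -> Icc a b y ->
  (forall t, Icc a b t -> f t = g t) -> C_RInt f x y = C_RInt g x y.
Proof.
  intros Hx Hy E. apply (RInt_ext (V := C_R_CompleteNormedModule)). intros t Ht. apply E.
  apply Icc_between with x y; auto; lra.
Qed.

Lemma C_RInt_clamp (a b : R) (f : R -> C) (x y : R) : Icc a b x -> Icc a b y ->
  C_RInt (fun t => f (clamp a b t)) x y = C_RInt f x y.
Proof.
  intros Hx Hy. apply (C_RInt_equal a b); auto.
  intros t Ht. rewrite clamp_id; auto.
Qed.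

Lemma is_RInt_C_RInt (a b : R) (f : R -> C) (x y : R) : Icc a b x -> Icc a b y ->
  continuous_on (Icc a b) f ->
  is_RInt (V := C_R_NormedModule) f x y (C_RInt f x y).
Proof.
  intros Hx Hy Hf. rewrite <- (C_RInt_clamp a b) by assumption.
  apply (is_RInt_ext (V := C_R_NormedModule)) with (fun t => f (clamp a b t)).
  - intros t Ht. rewrite clamp_id; auto. apply Icc_between with x y; auto; lra.
  - apply is_RInt_clamp; auto. unfold Icc in Hx; lra.
Qed.

Lemma C_RInt_unique (f : R -> C) (x y : R) (l : C) :
  is_RInt (V := C_R_NormedModule) f x y l -> C_RInt f x y = l.
Proof. apply (is_RInt_unique (V := C_R_CompleteNormedModule)). Qed.

Lemma C_RInt_point (f : R -> C) (x : R) : C_RInt f x x = 0.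
Proof. apply C_RInt_unique, (is_RInt_point (V := C_R_NormedModule)). Qed.

Lemma is_RInt_exp (D K c x y : R) : (K <> 0)%R ->
  is_RInt (V := R_NormedModule) (fun t => D * exp (K * (t - c)))%R x y
    (D / K * exp (K * (y - c)) - D / K * exp (K * (x - c)))%R.
Proof.
  intros HK.
  apply (is_RInt_derive (V := R_CompleteNormedModule) (fun t => D / K * exp (K * (t - c)))%R).
  - intros t _. auto_derive; [auto|]. unfold Rminus. field. exact HK.
  - intros t _. apply (ex_derive_continuous (V := R_NormedModule)). auto_derive. auto.
Qed.

(** Integration from [x0] contracts by the factor [1 / K] the norm weighted by
    [exp (- K * Rabs (x - x0))]. This one estimate controls the formal powers and
    the remainders in term-by-term integration. *)
Lemma C_RInt_exp_bound (a b : R) (g : R -> C) (D K x0 x : R) :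
  (0 < K)%R -> (0 <= D)%R -> Icc a b x0 -> Icc a b x ->
  continuous_on (Icc a b) g ->
  (forall y, Icc a b y -> (Cmod (g y) <= D * exp (K * Rabs (y - x0)))%R) ->
  (Cmod (C_RInt g x0 x) <= D / K * exp (K * Rabs (x - x0)))%R.
Proof.
  intros HK HD Hx0 Hx Hg Hb.
  assert (HDK : (0 <= D / K)%R) by (apply Rdiv_le_0_compat; assumption).
  destruct (Rle_or_lt x0 x) as [Hle|Hlt].
  - apply Rle_trans with (D / K * exp (K * (x - x0)) - D / K * exp (K * (x0 - x0)))%R.
    + rewrite <- norm_C_R.
      apply (norm_RInt_le (V := C_R_NormedModule) g
               (fun t => D * exp (K * (t - x0)))%R x0 x); [exact Hle | | |].
      * intros y Hy. rewrite norm_C_R.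
        rewrite <- (Rabs_pos_eq (y - x0)) by lra.
        apply Hb. apply Icc_between with x0 x; auto.
        rewrite Rmin_left, Rmax_right; lra.
      * apply is_RInt_C_RInt with a b; auto.
      * apply is_RInt_exp. lra.
    + rewrite Rabs_pos_eq by lra.
      assert (H := Rmult_le_pos _ _ HDK (Rlt_le _ _ (exp_pos (K * (x0 - x0))))). lra.
  - set (L := (- K)%R).
    apply Rle_trans with (D / L * exp (L * (x0 - x0)) - D / L * exp (L * (x - x0)))%R.
    + replace (C_RInt g x0 x) with (- (C_RInt g x x0)).
      2:{ symmetry. apply C_RInt_unique.
          apply (is_RInt_swap (V := C_R_NormedModule)).
          apply is_RInt_C_RInt with a b; auto. }
      rewrite Cmod_opp, <- norm_C_R.
      apply (norm_RInt_le (V := C_R_NormedModule) g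
               (fun t => D * exp (L * (t - x0)))%R x x0); [lra | | |].
      * intros y Hy. rewrite norm_C_R.
        replace (L * (y - x0))%R with (K * Rabs (y - x0))%R
          by (rewrite Rabs_left1; unfold L; lra).
        apply Hb. apply Icc_between with x x0; auto.
        rewrite Rmin_left, Rmax_right; lra.
      * apply is_RInt_C_RInt with a b; auto.
      * apply is_RInt_exp. unfold L. lra.
    + replace (K * Rabs (x - x0))%R with (L * (x - x0))%R
        by (rewrite Rabs_left; unfold L; lra).
      replace (D / L)%R with (- (D / K))%R by (unfold L; field; lra).
      assert (H := Rmult_le_pos _ _ HDK (Rlt_le _ _ (exp_pos (L * (x0 - x0))))). lra.
Qed.

(** * Derivatives on a segment *)

(** The base point of the filter is unique because [x] is a limit of points of the
    segment, so only the estimate at [x] itself remains. *)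
Lemma is_derive_on_Cmod (a b : R) (f : R -> C) (x : R) (l : C) : Icc a b x ->
  is_derive_on a b f x l <->
  forall eps : posreal, exists d : posreal, forall y, Icc a b y -> (Rabs (y - x) < d)%R ->
    (Cmod (f y - f x - (y - x)%R * l) <= eps * Rabs (y - x))%R.
Proof.
  intros Hx. split.
  - intros [_ H] eps.
    assert (Hlim : is_filter_lim (within (Icc a b) (locally x)) x).
    { intros P [d Hd]. exists d. intros y Hy _. apply Hd, Hy. }
    destruct (H x Hlim eps) as [d Hd]. exists d. intros y Hy Hyx.
    specialize (Hd y Hyx Hy). rewrite norm_C_R, scal_R_Cmult in Hd. exact Hd.
  - intros H. split; [apply (is_linear_scal_l (V := C_R_NormedModule))|].
    intros x' Hx'.
    assert (E : x = x').
    { assert (HF : ProperFilter' (within (Icc a b) (locally x))).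
      { split; [|apply within_filter, locally_filter].
        intros [d Hd]. apply (Hd x); [|exact Hx]. apply ball_center. }
      apply (is_filter_lim_unique (V := R_NormedModule) (FF := HF)); [|exact Hx'].
      intros P [d Hd]. exists d. intros y Hy _. apply Hd, Hy. }
    subst x'. intros eps. destruct (H eps) as [d Hd]. exists d. intros y Hyx Hy.
    specialize (Hd y Hy Hyx). rewrite norm_C_R, scal_R_Cmult. exact Hd.
Qed.

Lemma is_derive_on_equal (a b : R) (f g : R -> C) (x : R) (l m : C) :
  Icc a b x -> (forall y, Icc a b y -> f y = g y) -> l = m ->
  is_derive_on a b f x l -> is_derive_on a b g x m.
Proof.
  intros Hx E <-. rewrite !is_derive_on_Cmod by assumption. intros H eps.
  destruct (H eps) as [d Hd]. exists d. intros y Hy Hyx.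
  rewrite <- !E by assumption. apply Hd; assumption.
Qed.

Lemma is_derive_on_interior (a b : R) (f : R -> C) (x : R) (l : C) :
  (a < x < b)%R -> is_derive_on a b f x l ->
  is_derive (V := C_R_NormedModule) f x l.
Proof.
  intros Hx [H1 H2]. split; [exact H1|].
  intros x' Hx' eps.
  apply (is_filter_lim_locally_unique (V := R_NormedModule)) in Hx'. subst x'.
  assert (Hlim : is_filter_lim (within (Icc a b) (locally x)) x).
  { intros P [d Hd]. exists d. intros y Hy _. apply Hd, Hy. }
  specialize (H2 x Hlim eps).
  assert (Hl : locally x (fun y => Icc a b y)).
  { apply (filter_imp (fun y => a < y /\ y < b)%R); [unfold Icc; intros; lra|].
    apply (open_and _ _ (open_gt a) (open_lt b)). lra. }
  unfold within in H2. generalize (filter_and _ _ H2 Hl).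
  apply filter_imp. intros y [Ha Hb]. apply Ha, Hb.
Qed.

Lemma is_derive_on_of_is_derive (a b : R) (f : R -> C) (x : R) (l : C) :
  Icc a b x -> is_derive (V := C_R_NormedModule) f x l -> is_derive_on a b f x l.
Proof.
  intros Hx [_ H]. apply is_derive_on_Cmod; [exact Hx|]. intros eps.
  assert (Hlim : is_filter_lim (locally x) x) by (intros P HP; exact HP).
  destruct (H x Hlim eps) as [d Hd]. exists d. intros y _ Hyx.
  specialize (Hd y Hyx). rewrite norm_C_R, scal_R_Cmult in Hd. exact Hd.
Qed.

Lemma is_derive_on_C_RInt (a b : R) (f : R -> C) (x0 x : R) :
  Icc a b x0 -> Icc a b x -> continuous_on (Icc a b) f ->
  is_derive_on a b (fun y => C_RInt f x0 y) x (f x).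
Proof.
  intros Hx0 Hx Hf.
  apply (is_derive_on_equal a b (fun y => C_RInt (fun t => f (clamp a b t)) x0 y) _ x
          (f (clamp a b x))); [exact Hx | | now rewrite clamp_id |].
  - intros y Hy. now apply C_RInt_clamp.
  - assert (Hab : (a <= b)%R) by (unfold Icc in Hx; lra).
    apply is_derive_on_of_is_derive; [exact Hx|].
    apply (is_derive_RInt (V := C_R_NormedModule) (fun t => f (clamp a b t)) _ x0).
    + apply filter_forall. intros y. now apply is_RInt_clamp.
    + now apply continuous_clamp.
Qed.

Lemma is_derive_on_lipschitz (a b : R) (f : R -> C) (x : R) (l : C) :
  Icc a b x -> is_derive_on a b f x l ->
  exists d : posreal, forall y, Icc a b y -> (Rabs (y - x) < d)%R ->
    (Cmod (f y - f x) <= (Cmod l + 1) * Rabs (y - x))%R.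
Proof.
  intros Hx H. generalize (proj1 (is_derive_on_Cmod a b f x l Hx) H); clear H; intros H.
  destruct (H (mkposreal 1 Rlt_0_1)) as [d Hd]. exists d. intros y Hy Hyx.
  specialize (Hd y Hy Hyx). simpl in Hd.
  replace (f y - f x) with ((f y - f x - (y - x)%R * l) + (y - x)%R * l) by ring.
  eapply Rle_trans; [apply Cmod_triangle|]. rewrite Cmod_mult, Cmod_R. lra.
Qed.

Lemma is_derive_on_continuous_on (a b : R) (f df : R -> C) :
  (forall x, Icc a b x -> is_derive_on a b f x (df x)) -> continuous_on (Icc a b) f.
Proof.
  intros H. apply continuous_on_Cmod. intros x Hx eps.
  destruct (is_derive_on_lipschitz a b f x _ Hx (H x Hx)) as [d Hd].
  set (L := (Cmod (df x) + 1)%R) in Hd.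
  assert (HL : (0 < L)%R) by (generalize (Cmod_ge_0 (df x)); unfold L; lra).
  assert (He : (0 < eps / L)%R) by (apply Rdiv_lt_0_compat; [apply cond_pos | exact HL]).
  exists (mkposreal _ (Rmin_stable_in_posreal d (mkposreal _ He))).
  simpl. intros y Hy Hyx.
  apply Rle_lt_trans with (L * Rabs (y - x))%R.
  - apply Hd; [exact Hy|]. eapply Rlt_le_trans; [exact Hyx | apply Rmin_l].
  - replace (pos eps) with (L * (eps / L))%R by (field; lra).
    apply Rmult_lt_compat_l; [exact HL|]. eapply Rlt_le_trans; [exact Hyx | apply Rmin_r].
Qed.

Lemma is_derive_on_const (a b : R) (c : C) (x : R) : Icc a b x ->
  is_derive_on a b (fun _ => c) x 0.
Proof.
  intros Hx. apply is_derive_on_of_is_derive; [exact Hx|].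
  apply (is_derive_const (V := C_R_NormedModule)).
Qed.

Lemma is_derive_on_plus (a b : R) (f g : R -> C) (x : R) (l m : C) : Icc a b x ->
  is_derive_on a b f x l -> is_derive_on a b g x m ->
  is_derive_on a b (fun y => f y + g y) x (l + m).
Proof.
  intros Hx. rewrite !is_derive_on_Cmod by assumption. intros Hf Hg eps.
  destruct (Hf (pos_div_2 eps)) as [d1 H1], (Hg (pos_div_2 eps)) as [d2 H2].
  exists (mkposreal _ (Rmin_stable_in_posreal d1 d2)). simpl. intros y Hy Hyx.
  specialize (H1 y Hy (Rlt_le_trans _ _ _ Hyx (Rmin_l _ _))).
  specialize (H2 y Hy (Rlt_le_trans _ _ _ Hyx (Rmin_r _ _))). simpl in H1, H2.
  replace (f y + g y - (f x + g x) - (y - x)%R * (l + m)) with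
    ((f y - f x - (y - x)%R * l) + (g y - g x - (y - x)%R * m)) by ring.
  eapply Rle_trans; [apply Cmod_triangle|]. lra.
Qed.

Lemma is_derive_on_mult (a b : R) (f g : R -> C) (x : R) (l m : C) : Icc a b x ->
  is_derive_on a b f x l -> is_derive_on a b g x m ->
  is_derive_on a b (fun y => f y * g y) x (l * g x + f x * m).
Proof.
  intros Hx Df Dg.
  destruct (is_derive_on_lipschitz a b f x l Hx Df) as [d3 H3].
  destruct (is_derive_on_lipschitz a b g x m Hx Dg) as [d4 H4].
  generalize (proj1 (is_derive_on_Cmod a b f x l Hx) Df); clear Df; intros Df.
  generalize (proj1 (is_derive_on_Cmod a b g x m Hx) Dg); clear Dg; intros Dg.
  apply is_derive_on_Cmod; [exact Hx|]. intros eps.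
  set (L := (Cmod l + 1)%R) in *. set (M := (Cmod m + 1)%R) in *.
  assert (HL : (0 < L)%R) by (generalize (Cmod_ge_0 l); unfold L; lra).
  assert (HM : (0 < M)%R) by (generalize (Cmod_ge_0 m); unfold M; lra).
  assert (Hfx := Cmod_ge_0 (f x)). assert (Hgx := Cmod_ge_0 (g x)).
  assert (He := cond_pos eps).
  assert (E1 : (0 < eps / 3 / (Cmod (g x) + 1))%R) by (apply Rdiv_lt_0_compat; lra).
  assert (E2 : (0 < eps / 3 / (Cmod (f x) + 1))%R) by (apply Rdiv_lt_0_compat; lra).
  assert (E3 : (0 < eps / 3 / (L * M))%R).
  { apply Rdiv_lt_0_compat; [lra|]. now apply Rmult_lt_0_compat. }
  destruct (Df (mkposreal _ E1)) as [d1 H1], (Dg (mkposreal _ E2)) as [d2 H2].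
  simpl in H1, H2.
  set (dA := mkposreal _ (Rmin_stable_in_posreal d1 d2)).
  set (dB := mkposreal _ (Rmin_stable_in_posreal d3 d4)).
  set (dC := mkposreal _ (Rmin_stable_in_posreal dA dB)).
  exists (mkposreal _ (Rmin_stable_in_posreal dC (mkposreal _ E3))).
  intros y Hy Hyx. simpl in Hyx.
  apply Rmin_Rgt in Hyx as [Hyx F5].
  apply Rmin_Rgt in Hyx as [Fa Fb].
  apply Rmin_Rgt in Fa as [F1 F2]. apply Rmin_Rgt in Fb as [F3 F4].
  specialize (H1 y Hy F1). specialize (H2 y Hy F2).
  specialize (H3 y Hy F3). specialize (H4 y Hy F4).
  set (h := Rabs (y - x)) in *. assert (Hh : (0 <= h)%R) by apply Rabs_pos.
  replace (f y * g y - f x * g x - (y - x)%R * (l * g x + f x * m)) with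
    ((f y - f x - (y - x)%R * l) * g x + f x * (g y - g x - (y - x)%R * m)
       + (f y - f x) * (g y - g x)) by ring.
  eapply Rle_trans; [apply Cmod_triangle|].
  apply Rle_trans with (eps / 3 * h + eps / 3 * h + eps / 3 * h)%R; [|lra].
  apply Rplus_le_compat; [eapply Rle_trans; [apply Cmod_triangle|]; apply Rplus_le_compat|];
    rewrite Cmod_mult.
  - apply Rle_trans with (eps / 3 / (Cmod (g x) + 1) * h * (Cmod (g x) + 1))%R.
    + apply Rmult_le_compat; [apply Cmod_ge_0 | exact Hgx | exact H1 | lra].
    + right. field. lra.
  - apply Rle_trans with ((Cmod (f x) + 1) * (eps / 3 / (Cmod (f x) + 1) * h))%R.
    + apply Rmult_le_compat; [exact Hfx | apply Cmod_ge_0 | lra | exact H2].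
    + right. field. lra.
  - apply Rle_trans with ((L * h) * (M * h))%R.
    + apply Rmult_le_compat; [apply Cmod_ge_0 | apply Cmod_ge_0 | exact H3 | exact H4].
    + replace (L * h * (M * h))%R with (L * M * h * h)%R by ring.
      apply Rmult_le_compat_r; [exact Hh|].
      replace (eps / 3)%R with (L * M * (eps / 3 / (L * M)))%R by (field; lra).
      apply Rmult_le_compat_l; [apply Rlt_le, Rmult_lt_0_compat; assumption|]. apply Rlt_le, F5.
Qed.

Lemma is_derive_on_minus (a b : R) (f g : R -> C) (x : R) (l m : C) : Icc a b x ->
  is_derive_on a b f x l -> is_derive_on a b g x m ->
  is_derive_on a b (fun y => f y - g y) x (l - m).
Proof.
  intros Hx Hf Hg.
  apply (is_derive_on_equal a b (fun y => f y + (-1)%R * g y) _ x (l + (0 * g x + (-1)%R * m)));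
    [exact Hx | intros; ring | ring |].
  apply is_derive_on_plus; auto.
  apply (is_derive_on_mult a b (fun _ => RtoC (-1)) g); auto. now apply is_derive_on_const.
Qed.

Lemma is_derive_on_inv (a b : R) (f : R -> C) (x : R) (l : C) : Icc a b x ->
  (forall y, Icc a b y -> f y <> 0) -> is_derive_on a b f x l ->
  is_derive_on a b (fun y => / f y) x (- l / (f x * f x)).
Proof.
  intros Hx Hnz Df.
  destruct (is_derive_on_lipschitz a b f x l Hx Df) as [d1 H1].
  generalize (proj1 (is_derive_on_Cmod a b f x l Hx) Df); clear Df; intros Df.
  apply is_derive_on_Cmod; [exact Hx|]. intros eps.
  set (L := (Cmod l + 1)%R) in *.
  assert (HL : (0 < L)%R) by (generalize (Cmod_ge_0 l); unfold L; lra).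
  set (c := Cmod (f x)).
  assert (Hc : (0 < c)%R) by (apply Cmod_gt_0, Hnz, Hx).
  assert (He := cond_pos eps).
  assert (E1 : (0 < eps * c * c / 4)%R) by (repeat apply Rmult_lt_0_compat; lra).
  assert (E2 : (0 < c / (2 * L))%R) by (apply Rdiv_lt_0_compat; lra).
  assert (E3 : (0 < eps * c * c * c / 4 / (L * L))%R).
  { apply Rdiv_lt_0_compat; [|now apply Rmult_lt_0_compat].
    repeat apply Rmult_lt_0_compat; lra. }
  destruct (Df (mkposreal _ E1)) as [d2 H2]. simpl in H2.
  set (dA := mkposreal _ (Rmin_stable_in_posreal d1 d2)).
  set (dB := mkposreal _ (Rmin_stable_in_posreal (mkposreal _ E2) (mkposreal _ E3))).
  exists (mkposreal _ (Rmin_stable_in_posreal dA dB)).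
  intros y Hy Hyx. simpl in Hyx.
  apply Rmin_Rgt in Hyx as [Fa Fb].
  apply Rmin_Rgt in Fa as [F1 F2]. apply Rmin_Rgt in Fb as [F3 F4].
  specialize (H1 y Hy F1). specialize (H2 y Hy F2).
  set (h := Rabs (y - x)) in *. assert (Hh : (0 <= h)%R) by apply Rabs_pos.
  assert (Hfy : (c / 2 <= Cmod (f y))%R).
  { assert (T : (c <= Cmod (f y) + Cmod (f y - f x))%R).
    { unfold c. replace (f x) with (f y + - (f y - f x)) at 1 by ring.
      eapply Rle_trans; [apply Cmod_triangle|]. rewrite Cmod_opp. lra. }
    assert (L * h <= c / 2)%R.
    { replace (c / 2)%R with (L * (c / (2 * L)))%R by (field; lra).
      apply Rmult_le_compat_l; lra. }
    lra. }
  assert (Hnx := Hnz x Hx). assert (Hny := Hnz y Hy).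
  (* over the common denominator, the numerator is the square of the increment of [f]
     minus the error term of [f] times [f y] *)
  replace (/ f y - / f x - (y - x)%R * (- l / (f x * f x))) with
    (((f y - f x) * (f y - f x) - (f y - f x - (y - x)%R * l) * f y) / (f x * f x * f y))
    by (field; auto).
  rewrite Cmod_div, !Cmod_mult by (repeat apply Cmult_neq_0; assumption).
  fold c.
  assert (Hp : (0 < c * c * Cmod (f y))%R) by (repeat apply Rmult_lt_0_compat; lra).
  apply Rle_div_l; [exact Hp|].
  unfold Cminus at 1. eapply Rle_trans; [apply Cmod_triangle|].
  rewrite Cmod_opp, !Cmod_mult.
  apply Rle_trans with (eps * c * c * c / 4 * h + (eps * c * c / 4 * h) * Cmod (f y))%R.
  - apply Rplus_le_compat.
    + apply Rle_trans with ((L * h) * (L * h))%R.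
      * apply Rmult_le_compat; try apply Cmod_ge_0; assumption.
      * replace (L * h * (L * h))%R with (L * L * h * h)%R by ring.
        apply Rmult_le_compat_r; [exact Hh|].
        replace (eps * c * c * c / 4)%R with (L * L * (eps * c * c * c / 4 / (L * L)))%R
          by (field; lra).
        apply Rmult_le_compat_l; [apply Rlt_le, Rmult_lt_0_compat; assumption | lra].
    + apply Rmult_le_compat_r; [apply Cmod_ge_0 | exact H2].
  - assert (T : (0 <= eps * c * c * h)%R) by (repeat apply Rmult_le_pos; lra).
    assert (T2 := Rmult_le_compat_l _ _ _ T Hfy).
    assert (T3 : (0 <= eps * c * c * h * Cmod (f y))%R) by (apply Rmult_le_pos; [exact T | lra]).
    nra.
Qed.

Lemma Icc_interior_near (a b x d : R) : (a < b)%R -> Icc a b x -> (0 < d)%R ->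
  exists y, (a < y < b)%R /\ (0 < Rabs (y - x) < d)%R.
Proof.
  intros Hab [Ha Hb'] Hd.
  destruct (Rlt_le_dec x b) as [Hb|Hb].
  - exists (x + Rmin ((b - x) / 2) (d / 2))%R.
    assert (0 < Rmin ((b - x) / 2) (d / 2))%R by (apply Rmin_pos; lra).
    assert (T1 := Rmin_l ((b - x) / 2) (d / 2)).
    assert (T2 := Rmin_r ((b - x) / 2) (d / 2)).
    rewrite Rabs_pos_eq; lra.
  - exists (x - Rmin ((x - a) / 2) (d / 2))%R.
    assert (0 < Rmin ((x - a) / 2) (d / 2))%R by (apply Rmin_pos; lra).
    assert (T1 := Rmin_l ((x - a) / 2) (d / 2)).
    assert (T2 := Rmin_r ((x - a) / 2) (d / 2)).
    rewrite Rabs_left; lra.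
Qed.

Lemma is_derive_on_unique (a b : R) (f : R -> C) (x : R) (l m : C) :
  (a < b)%R -> Icc a b x -> is_derive_on a b f x l -> is_derive_on a b f x m -> l = m.
Proof.
  intros Hab Hx Hl Hm.
  assert (D : is_derive_on a b (fun _ => 0) x (l - m)).
  { apply (is_derive_on_equal a b (fun y => f y - f y) _ x (l - m)); auto.
    - intros; ring.
    - now apply is_derive_on_minus. }
  destruct (Ceq_dec (l - m) 0) as [E|E].
  { replace l with (l - m + m) by ring. rewrite E. ring. }
  exfalso. generalize (proj1 (is_derive_on_Cmod a b _ x _ Hx) D); clear D; intros D.
  assert (Hp := proj1 (Cmod_gt_0 _) E).
  destruct (D (pos_div_2 (mkposreal _ Hp))) as [d Hd]. simpl in Hd.
  assert (Hdp := cond_pos d).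
  destruct (Icc_interior_near a b x d Hab Hx Hdp) as [y [Hyi [Hy1 Hy2]]].
  assert (Hy : Icc a b y) by (unfold Icc; lra). specialize (Hd y Hy Hy2).
  replace (0 - 0 - (y - x)%R * (l - m)) with (- ((y - x)%R * (l - m))) in Hd by ring.
  rewrite Cmod_opp, Cmod_mult, Cmod_R in Hd. nra.
Qed.

(** Inside the segment the derivative is two-sided and the mean value theorem
    applies; the end points follow by continuity. *)
Lemma is_derive_on_zero_const (a b : R) (f : R -> C) :
  (a < b)%R -> (forall x, Icc a b x -> is_derive_on a b f x 0) ->
  forall x y, Icc a b x -> Icc a b y -> f x = f y.
Proof.
  intros Hab H.
  assert (Hint : forall x y, (a < x)%R -> (x < y)%R -> (y < b)%R -> f x = f y).
  { intros x y H1 H2 H3.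
    apply (eq_is_derive (V := C_R_NormedModule) f x y); [|exact H2].
    intros t Ht. apply (is_derive_on_interior a b); [lra|]. apply H. unfold Icc; lra. }
  set (c := ((a + b) / 2)%R).
  assert (Hcint : forall x, (a < x < b)%R -> f x = f c).
  { intros x Hx. destruct (Rtotal_order x c) as [L|[->|L]]; [|reflexivity|].
    - apply Hint; unfold c in *; lra.
    - symmetry. apply Hint; unfold c in *; lra. }
  assert (Hc : forall x, Icc a b x -> f x = f c).
  { intros x Hx.
    destruct (Ceq_dec (f c - f x) 0) as [E|E].
    { replace (f c) with (f c - f x + f x) by ring. rewrite E. ring. }
    exfalso. assert (Hp := proj1 (Cmod_gt_0 _) E).
    assert (Hcont := is_derive_on_continuous_on a b f _ H).
    destruct (proj1 (continuous_on_Cmod a b f) Hcont x Hx (mkposreal _ Hp)) as [d Hd].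
    simpl in Hd. assert (Hdp := cond_pos d).
    destruct (Icc_interior_near a b x d Hab Hx Hdp) as [y [Hy1 [_ Hy2]]].
    assert (Hyi : Icc a b y) by (unfold Icc; lra).
    specialize (Hd y Hyi Hy2). rewrite (Hcint y Hy1) in Hd. lra. }
  intros x y Hx Hy. now rewrite (Hc x Hx), (Hc y Hy).
Qed.

(** * Series dominated by a geometric series *)

Lemma half_pow_pos (n : nat) : (0 < (/ 2) ^ n)%R.
Proof. apply pow_lt. lra. Qed.

Lemma half_pow_small (D : R) (eps : posreal) :
  exists N : nat, forall n, (N <= n)%nat -> (D * (/ 2) ^ n < eps)%R.
Proof.
  assert (HD : (0 < Rabs D + 1)%R) by (generalize (Rabs_pos D); lra).
  assert (He : (0 < eps / (Rabs D + 1))%R) by (apply Rdiv_lt_0_compat; [apply cond_pos | exact HD]).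
  destruct (pow_lt_1_zero (/ 2) ltac:(rewrite Rabs_pos_eq; lra) _ He) as [N HN].
  exists N. intros n Hn. specialize (HN n Hn).
  rewrite Rabs_pos_eq in HN by (apply Rlt_le, half_pow_pos).
  assert (Hp := half_pow_pos n).
  apply Rle_lt_trans with ((Rabs D + 1) * (/ 2) ^ n)%R.
  - apply Rmult_le_compat_r; [lra|]. generalize (Rle_abs D); lra.
  - replace (pos eps) with ((Rabs D + 1) * (eps / (Rabs D + 1)))%R by (field; lra).
    apply Rmult_lt_compat_l; assumption.
Qed.

Lemma C_Series_unique (s : nat -> C) (l : C) :
  is_series (V := C_NormedModule) s l -> C_Series s = l.
Proof.
  intros H. apply (iota_unique (V := C_CompleteNormedModule)); [|exact H].
  intros y Hy.
  exact (filterlim_locally_unique (V := C_NormedModule) (F := eventually) _ _ _ Hy H).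
Qed.

Lemma is_series_of_tail (s : nat -> C) (S : C) (D : R) :
  (forall n, (Cmod (sum_n s n - S) <= D * (/ 2) ^ n)%R) ->
  is_series (V := C_NormedModule) s S.
Proof.
  intros H. apply (proj2 (filterlim_locally_ball_norm (U := C_NormedModule) _ _)).
  intros eps. destruct (half_pow_small D eps) as [N HN]. exists N. intros n Hn.
  unfold ball_norm. eapply Rle_lt_trans; [apply (H n) | now apply HN].
Qed.

Lemma geometric_series (s : nat -> C) (D : R) : (0 <= D)%R ->
  (forall n, (Cmod (s n) <= D * (/ 2) ^ n)%R) ->
  is_series (V := C_NormedModule) s (C_Series s) /\
  forall n, (Cmod (sum_n s n - C_Series s) <= D * (/ 2) ^ n)%R.
Proof.
  intros HD Hs.
  assert (Hex : ex_series (V := C_CompleteNormedModule) s).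
  { apply (ex_series_le (V := C_CompleteNormedModule) s (fun n => D * (/ 2) ^ n)%R); [exact Hs|].
    apply (ex_series_scal (K := R_AbsRing) (V := R_NormedModule) D).
    apply ex_series_geom. rewrite Rabs_pos_eq; lra. }
  destruct Hex as [S HS].
  rewrite (C_Series_unique s S HS). split; [exact HS|]. intros n.
  assert (Hk : forall k, (Cmod (sum_n s n - sum_n s (n + k)%nat)
                          <= D * (/ 2) ^ n * (1 - (/ 2) ^ k))%R).
  { induction k as [|k IH].
    - rewrite Nat.add_0_r. replace (sum_n s n - sum_n s n) with (RtoC 0) by ring.
      rewrite Cmod_0. simpl. lra.
    - rewrite Nat.add_succ_r, sum_Sn.
      change (plus (sum_n s (n + k)%nat) (s (Datatypes.S (n + k))))
        with (sum_n s (n + k)%nat + s (Datatypes.S (n + k))).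
      match goal with |- (Cmod (?u - (?v + ?t)) <= _)%R =>
        replace (u - (v + t)) with ((u - v) + - t) by ring end.
      eapply Rle_trans; [apply Cmod_triangle|]. rewrite Cmod_opp.
      specialize (Hs (Datatypes.S (n + k))).
      replace ((/ 2) ^ Datatypes.S (n + k))%R with ((/ 2) ^ n * ((/ 2) ^ k * / 2))%R in Hs
        by (simpl; rewrite pow_add; ring).
      simpl. lra. }
  apply le_epsilon. intros eps Heps.
  destruct (proj1 (filterlim_locally_ball_norm (U := C_NormedModule) _ _) HS (mkposreal eps Heps))
    as [M HM].
  specialize (HM (n + M)%nat ltac:(lia)). unfold ball_norm in HM.
  change (Cmod (sum_n s (n + M)%nat - S) < eps)%R in HM.
  replace (sum_n s n - S) with
    ((sum_n s n - sum_n s (n + M)%nat) + (sum_n s (n + M)%nat - S)) by ring.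
  eapply Rle_trans; [apply Cmod_triangle|].
  specialize (Hk M).
  assert (T : (0 <= D * (/ 2) ^ n * (/ 2) ^ M)%R)
    by (repeat apply Rmult_le_pos; try apply Rlt_le, half_pow_pos; exact HD).
  lra.
Qed.

Lemma continuous_on_sum_n (a b : R) (f : nat -> R -> C) (n : nat) :
  (forall k, continuous_on (Icc a b) (f k)) ->
  continuous_on (Icc a b) (fun x => sum_n (fun k => f k x) n).
Proof.
  intros H. induction n as [|n IH].
  - apply continuous_on_equal with (f 0%nat); [|apply H].
    intros x _. now rewrite sum_O.
  - apply continuous_on_equal with (fun x => sum_n (fun k => f k x) n + f (S n) x).
    + intros x _. now rewrite sum_Sn.
    + apply continuous_on_plus; auto.
Qed.

Lemma continuous_on_C_Series (a b : R) (g : nat -> R -> C) (D : R) : (0 <= D)%R ->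
  (forall n, continuous_on (Icc a b) (g n)) ->
  (forall n x, Icc a b x -> (Cmod (g n x) <= D * (/ 2) ^ n)%R) ->
  continuous_on (Icc a b) (fun x => C_Series (fun n => g n x)).
Proof.
  intros HD Hc Hb. apply continuous_on_Cmod. intros x Hx eps.
  assert (He := cond_pos eps).
  assert (He3 : (0 < eps / 3)%R) by lra.
  destruct (half_pow_small D (mkposreal _ He3)) as [N HN]. simpl in HN.
  assert (HT : forall y, Icc a b y ->
    (Cmod (sum_n (fun k => g k y) N - C_Series (fun k => g k y)) < eps / 3)%R).
  { intros y Hy. eapply Rle_lt_trans; [|apply (HN N (le_n _))].
    apply (geometric_series (fun k => g k y) D HD). intros n. now apply Hb. }
  destruct (proj1 (continuous_on_Cmod _ _ _) (continuous_on_sum_n a b g N Hc) x Hx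
              (mkposreal _ He3)) as [d Hd]. simpl in Hd.
  exists d. intros y Hy Hyx. specialize (Hd y Hy Hyx).
  assert (H1 := HT x Hx). assert (H2 := HT y Hy).
  set (Sx := C_Series (fun n => g n x)) in *. set (Sy := C_Series (fun n => g n y)) in *.
  set (sx := sum_n (fun k => g k x) N) in *. set (sy := sum_n (fun k => g k y) N) in *.
  replace (Sy - Sx) with (- (sy - Sy) + ((sy - sx) + (sx - Sx))) by ring.
  eapply Rle_lt_trans; [apply Cmod_triangle|]. rewrite Cmod_opp.
  assert (H3 := Cmod_triangle (sy - sx) (sx - Sx)). lra.
Qed.

Lemma C_RInt_plus (a b : R) (f g : R -> C) (x y : R) : Icc a b x -> Icc a b y ->
  continuous_on (Icc a b) f -> continuous_on (Icc a b) g ->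
  C_RInt (fun t => f t + g t) x y = C_RInt f x y + C_RInt g x y.
Proof.
  intros Hx Hy Hf Hg. apply C_RInt_unique.
  apply (is_RInt_plus (V := C_R_NormedModule)); apply is_RInt_C_RInt with a b; assumption.
Qed.

Lemma C_RInt_minus (a b : R) (f g : R -> C) (x y : R) : Icc a b x -> Icc a b y ->
  continuous_on (Icc a b) f -> continuous_on (Icc a b) g ->
  C_RInt (fun t => f t - g t) x y = C_RInt f x y - C_RInt g x y.
Proof.
  intros Hx Hy Hf Hg. apply C_RInt_unique.
  apply (is_RInt_minus (V := C_R_NormedModule)); apply is_RInt_C_RInt with a b; assumption.
Qed.

Lemma C_RInt_sum_n (a b : R) (g : nat -> R -> C) (x y : R) (n : nat) :
  Icc a b x -> Icc a b y -> (forall k, continuous_on (Icc a b) (g k)) ->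
  C_RInt (fun t => sum_n (fun k => g k t) n) x y = sum_n (fun k => C_RInt (g k) x y) n.
Proof.
  intros Hx Hy Hg. induction n as [|n IH].
  - rewrite sum_O. apply (C_RInt_equal a b); auto. intros t _. now rewrite sum_O.
  - rewrite sum_Sn, <- IH.
    rewrite (C_RInt_equal a b _ (fun t => sum_n (fun k => g k t) n + g (S n) t)); auto.
    + apply (C_RInt_plus a b); auto. now apply continuous_on_sum_n.
    + intros t _. now rewrite sum_Sn.
Qed.

(** Term-by-term integration. *)
Lemma is_series_C_RInt (a b : R) (g : nat -> R -> C) (D x0 x : R) : (0 <= D)%R ->
  Icc a b x0 -> Icc a b x ->
  (forall n, continuous_on (Icc a b) (g n)) ->
  (forall n y, Icc a b y -> (Cmod (g n y) <= D * (/ 2) ^ n)%R) ->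
  is_series (V := C_NormedModule) (fun n => C_RInt (g n) x0 x)
    (C_RInt (fun y => C_Series (fun n => g n y)) x0 x).
Proof.
  intros HD Hx0 Hx Hc Hb.
  assert (HS := continuous_on_C_Series a b g D HD Hc Hb).
  apply is_series_of_tail with (D / 1 * exp (1 * Rabs (x - x0)))%R. intros n.
  rewrite <- (C_RInt_sum_n a b) by auto.
  assert (HcS := continuous_on_sum_n a b g n Hc).
  rewrite <- (C_RInt_minus a b) by auto.
  replace (D / 1 * exp (1 * Rabs (x - x0)) * (/ 2) ^ n)%R with
    (D * (/ 2) ^ n / 1 * exp (1 * Rabs (x - x0)))%R by field.
  assert (Hp := half_pow_pos n).
  assert (HDn : (0 <= D * (/ 2) ^ n)%R) by (apply Rmult_le_pos; lra).
  apply (C_RInt_exp_bound a b); auto; [lra | | ].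
  - apply continuous_on_equal with
      (fun y => sum_n (fun k => g k y) n + (-1)%R * C_Series (fun k => g k y)).
    + intros y _. ring.
    + apply continuous_on_plus; auto. apply continuous_on_mult; auto.
      apply continuous_on_const.
  - intros y Hy. eapply Rle_trans.
    + apply (geometric_series (fun k => g k y) D HD). intros m. now apply Hb.
    + rewrite <- (Rmult_1_r (D * (/ 2) ^ n)) at 1.
      apply Rmult_le_compat_l; [exact HDn|].
      generalize (exp_ineq1_le (1 * Rabs (y - x0))) (Rabs_pos (y - x0)). lra.
Qed.

Lemma Cmod_sum_n_m_le (s : nat -> C) (N : nat) (D : R) :
  (forall k, (1 <= k <= N)%nat -> (Cmod (s k) <= D)%R) ->
  (Cmod (sum_n_m s 1 N) <= INR N * D)%R.
Proof.
  induction N as [|N IH]; intros H.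
  - rewrite sum_n_m_zero by lia. change (Cmod (RtoC 0) <= INR 0 * D)%R.
    rewrite Cmod_0. simpl. lra.
  - rewrite sum_n_Sm by lia. rewrite S_INR.
    eapply Rle_trans; [apply Cmod_triangle|].
    assert (H1 : (Cmod (sum_n_m s 1 N) <= INR N * D)%R) by (apply IH; intros; apply H; lia).
    assert (H2 := H (S N) ltac:(lia)). lra.
Qed.

(** The sequence [c, 0, 0, ...]: the constants of integration of the recursion,
    nonzero at the initial step only. *)
Definition at_zero (c : C) (n : nat) : C := match n with O => c | S _ => 0 end.

Lemma at_zero_bound (c : C) (n : nat) : (Cmod (at_zero c n) <= Cmod c * (/ 2) ^ n)%R.
Proof.
  destruct n; simpl; [lra|]. rewrite Cmod_0.
  apply Rmult_le_pos; [apply Cmod_ge_0|]. apply (Rlt_le _ _ (half_pow_pos (S n))).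
Qed.

Lemma is_series_at_zero (c : C) : is_series (V := C_NormedModule) (at_zero c) c.
Proof.
  apply is_series_of_tail with 0%R. intros n.
  replace (sum_n (at_zero c) n) with c.
  - replace (c - c) with (RtoC 0) by ring. rewrite Cmod_0. lra.
  - induction n as [|n IH]; [now rewrite sum_O|].
    rewrite sum_Sn, <- IH. change (c = c + 0). ring.
Qed.

Lemma is_series_sum_n_m (s : nat -> nat -> C) (l : nat -> C) (N : nat) :
  (forall k, (1 <= k <= N)%nat -> is_series (V := C_NormedModule) (s k) (l k)) ->
  is_series (V := C_NormedModule) (fun n => sum_n_m (fun k => s k n) 1 N) (sum_n_m l 1 N).
Proof.
  induction N as [|N IH]; intros H.
  - rewrite sum_n_m_zero by lia.
    apply is_series_ext with (at_zero 0); [|apply is_series_at_zero].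
    intros n. rewrite sum_n_m_zero by lia. now destruct n.
  - rewrite sum_n_Sm by lia.
    apply is_series_ext with (fun n => plus (sum_n_m (fun k => s k n) 1 N) (s (S N) n)).
    + intros n. rewrite sum_n_Sm; [reflexivity | lia].
    + apply (is_series_plus (V := C_NormedModule)); [apply IH; intros; apply H; lia | apply H; lia].
Qed.

(** Delaying a sequence that vanishes at negative indices does not change its sum. *)
Lemma is_series_shift (A : Z -> C) (l : C) (k : nat) :
  (forall n, (n < 0)%Z -> A n = 0) ->
  is_series (V := C_NormedModule) (fun n => A (Z.of_nat n)) l ->
  is_series (V := C_NormedModule) (fun n => A (Z.of_nat n - Z.of_nat k)%Z) l.
Proof.
  intros HA Hl. induction k as [|k IH].
  - apply is_series_ext with (2 := Hl). intros n. f_equal. lia.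
  - apply is_series_decr_1. rewrite (HA _) by lia.
    change (is_series (V := C_NormedModule)
      (fun n => A (Z.of_nat (S n) - Z.of_nat (S k))%Z) (l + - 0)).
    replace (l + - 0) with l by ring.
    apply is_series_ext with (2 := IH). intros n. f_equal. lia.
Qed.

(** * The coupled recursion *)

(** The recursion shared by the two families of formal powers: [B n] is a primitive
    of the sum of [rho k * A (n - k)] over [k = 1, ..., N], and [A n] is a primitive
    of [P * B n]. The primitives vanish at [x0] except those of index 0, which take
    there the values [alpha] and [beta]. The indices of [A] are integers so that the
    delayed terms [A (n - k)] with [n < k] are simply zero. *)
Definition coupled_recursion (N : nat) (a b x0 : R) (P : R -> C) (rho : nat -> R -> C)
    (alpha beta : C) (A : Z -> R -> C) (B : nat -> R -> C) : Prop :=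
  (forall n x, (n < 0)%Z -> Icc a b x -> A n x = 0) /\
  (forall (n : nat) x, Icc a b x ->
     A (Z.of_nat n) x = at_zero alpha n + C_RInt (fun y => P y * B n y) x0 x) /\
  (forall (n : nat) x, Icc a b x ->
     B n x = at_zero beta n +
       C_RInt (fun y => sum_n_m (fun k => rho k y * A (Z.of_nat n - Z.of_nat k)%Z y) 1 N) x0 x).

Lemma continuous_on_antiderivative (a b x0 : R) (c : C) (f g : R -> C) :
  Icc a b x0 -> continuous_on (Icc a b) g ->
  (forall x, Icc a b x -> f x = c + C_RInt g x0 x) ->
  (forall x, Icc a b x -> is_derive_on a b f x (g x)) /\ continuous_on (Icc a b) f.
Proof.
  intros Hx0 Hg E.
  assert (H : forall x, Icc a b x -> is_derive_on a b f x (g x)).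
  { intros x Hx. apply (is_derive_on_equal a b (fun y => c + C_RInt g x0 y) _ x (0 + g x));
      [exact Hx | intros; now rewrite E | ring |].
    apply (is_derive_on_plus a b (fun _ => c)); [exact Hx | now apply is_derive_on_const |].
    now apply is_derive_on_C_RInt. }
  split; [exact H|]. now apply is_derive_on_continuous_on with g.
Qed.

(** Under a bound decaying like [2 ^ - n], a delay by at most [N] costs at most a
    factor [2 ^ N]. *)
Lemma delayed_sum_bound (N n : nat) (rho : nat -> C) (A : Z -> C) (M D : R) :
  (0 <= M)%R -> (0 <= D)%R ->
  (forall k, (1 <= k <= N)%nat -> (Cmod (rho k) <= M)%R) ->
  (forall j, (j < 0)%Z -> A j = 0) ->
  (forall j, (j < n)%nat -> (Cmod (A (Z.of_nat j)) <= D * (/ 2) ^ j)%R) ->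
  (Cmod (sum_n_m (fun k => (rho k * A (Z.of_nat n - Z.of_nat k)%Z)%C) 1 N)
    <= INR N * M * 2 ^ N * (D * (/ 2) ^ n))%R.
Proof.
  intros HM HD Hrho HA0 HA.
  replace (INR N * M * 2 ^ N * (D * (/ 2) ^ n))%R
    with (INR N * (M * (D * (2 ^ N * (/ 2) ^ n))))%R by ring.
  apply Cmod_sum_n_m_le. intros k Hk. rewrite Cmod_mult.
  apply Rmult_le_compat; try apply Cmod_ge_0; [now apply Hrho|].
  assert (H2N : (0 < 2 ^ N)%R) by (apply pow_lt; lra).
  destruct (le_lt_dec k n) as [Hkn|Hkn].
  - replace (Z.of_nat n - Z.of_nat k)%Z with (Z.of_nat (n - k)) by lia.
    eapply Rle_trans; [apply HA; lia|].
    apply Rmult_le_compat_l; [exact HD|].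
    replace n with ((n - k) + k)%nat at 2 by lia. rewrite pow_add.
    rewrite (Rmult_comm (2 ^ N)), Rmult_assoc.
    rewrite <- (Rmult_1_r ((/ 2) ^ (n - k))) at 1.
    apply Rmult_le_compat_l; [apply Rlt_le, half_pow_pos|].
    replace 1%R with ((/ 2) ^ k * 2 ^ k)%R
      by (rewrite <- Rpow_mult_distr, Rinv_l, pow1; lra).
    apply Rmult_le_compat_l; [apply Rlt_le, half_pow_pos|].
    apply Rle_pow; [lra | lia].
  - rewrite HA0 by lia. rewrite Cmod_0.
    assert (Hp := half_pow_pos n).
    repeat apply Rmult_le_pos; lra.
Qed.

Lemma delayed_sum_continuous (a b : R) (N n : nat) (rho : nat -> R -> C) (A : Z -> R -> C) :
  (forall k, (1 <= k <= N)%nat -> continuous_on (Icc a b) (rho k)) ->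
  (forall j x, (j < 0)%Z -> Icc a b x -> A j x = 0) ->
  (forall j, (j < n)%nat -> continuous_on (Icc a b) (A (Z.of_nat j))) ->
  continuous_on (Icc a b)
    (fun y => sum_n_m (fun k => rho k y * A (Z.of_nat n - Z.of_nat k)%Z y) 1 N).
Proof.
  intros Hrho HA0 HA. apply continuous_on_sum. intros k Hk.
  apply continuous_on_mult; [now apply Hrho|].
  destruct (le_lt_dec k n) as [Hkn|Hkn].
  - replace (Z.of_nat n - Z.of_nat k)%Z with (Z.of_nat (n - k)) by lia.
    apply HA. lia.
  - apply continuous_on_equal with (fun _ => 0); [|apply continuous_on_const].
    intros x Hx. rewrite HA0; [reflexivity | lia | exact Hx].
Qed.

Lemma family_bounded (a b : R) (N : nat) (rho : nat -> R -> C) : (a <= b)%R ->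
  (forall k, (1 <= k <= N)%nat -> continuous_on (Icc a b) (rho k)) ->
  exists M, (0 < M)%R /\ forall k x, (1 <= k <= N)%nat -> Icc a b x ->
    (Cmod (rho k x) <= M)%R.
Proof.
  intros Hab. induction N as [|N IH]; intros Hrho.
  - exists 1%R. split; [lra|]. intros; lia.
  - destruct IH as [M [HM IH]]; [intros; apply Hrho; lia|].
    destruct (continuous_on_bounded a b (rho (S N)) Hab (Hrho (S N) ltac:(lia)))
      as [M' [HM' H']].
    exists (M + M')%R. split; [lra|]. intros k x Hk Hx.
    destruct (Nat.eq_dec k (S N)) as [->|Hne].
    + specialize (H' x Hx). lra.
    + specialize (IH k x ltac:(lia) Hx). lra.
Qed.

(** Induction on [n] in the weighted norm gives
    [Cmod (A n x) <= 2 * c * (/ 2) ^ n * exp (K * Rabs (x - x0))], and the same for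
    [B n]: with [K] large compared with [P] and [2 ^ N * rho], each integration
    at least halves the constant, which leaves room for the initial value. *)
Lemma coupled_bounds N a b x0 P rho alpha beta A B :
  Icc a b x0 -> continuous_on (Icc a b) P ->
  (forall k, (1 <= k <= N)%nat -> continuous_on (Icc a b) (rho k)) ->
  coupled_recursion N a b x0 P rho alpha beta A B ->
  exists D : R, (0 <= D)%R /\ forall n : nat,
    (continuous_on (Icc a b) (A (Z.of_nat n)) /\
     forall x, Icc a b x -> (Cmod (A (Z.of_nat n) x) <= D * (/ 2) ^ n)%R) /\
    (continuous_on (Icc a b) (B n) /\
     forall x, Icc a b x -> (Cmod (B n x) <= D * (/ 2) ^ n)%R).
Proof.
  intros Hx0 HP Hrho [HA0 [HA HB]].
  assert (Hab : (a <= b)%R) by (unfold Icc in Hx0; lra).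
  destruct (continuous_on_bounded a b P Hab HP) as [M1 [HM1 HPM]].
  destruct (family_bounded a b N rho Hab Hrho) as [M2 [HM2 HrhoM]].
  set (c := (Cmod alpha + Cmod beta + 1)%R).
  assert (Hca : (Cmod alpha <= c)%R) by (generalize (Cmod_ge_0 beta); unfold c; lra).
  assert (Hcb : (Cmod beta <= c)%R) by (generalize (Cmod_ge_0 alpha); unfold c; lra).
  assert (Hc : (0 < c)%R) by (generalize (Cmod_ge_0 alpha) (Cmod_ge_0 beta); unfold c; lra).
  set (Q := (INR N * M2 * 2 ^ N)%R).
  assert (HQ : (0 <= Q)%R).
  { unfold Q. repeat apply Rmult_le_pos; [apply pos_INR | lra | apply pow_le; lra]. }
  set (K := (2 * (M1 + Q))%R).
  assert (HK : (0 < K)%R) by (unfold K; lra).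
  set (E := fun x => exp (K * Rabs (x - x0))).
  assert (HE : forall x, (1 <= E x)%R).
  { intros x. unfold E.
    assert (H := exp_ineq1_le (K * Rabs (x - x0))).
    assert (H' := Rmult_le_pos _ _ (Rlt_le _ _ HK) (Rabs_pos (x - x0))). lra. }
  (* each integration divides the weighted norm by [K] *)
  assert (Step : forall (n : nat) (z : C) (f g : R -> C) (M : R), (Cmod z <= c)%R ->
    (0 <= M)%R -> (2 * M <= K)%R -> continuous_on (Icc a b) g ->
    (forall y, Icc a b y -> (Cmod (g y) <= (M * (2 * c * (/ 2) ^ n)) * E y)%R) ->
    (forall x, Icc a b x -> f x = at_zero z n + C_RInt g x0 x) ->
    continuous_on (Icc a b) f /\
    forall x, Icc a b x -> (Cmod (f x) <= 2 * c * (/ 2) ^ n * E x)%R).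
  { intros n z f g M Hz HM HMK Hg Hgb Hf.
    split; [now apply (continuous_on_antiderivative a b x0 (at_zero z n) f g)|].
    intros x Hx. rewrite Hf by exact Hx.
    eapply Rle_trans; [apply Cmod_triangle|].
    assert (Hp := half_pow_pos n). assert (HEx := HE x).
    assert (Hcp : (0 < c * (/ 2) ^ n)%R) by (apply Rmult_lt_0_compat; assumption).
    assert (T1 : (Cmod (at_zero z n) <= c * (/ 2) ^ n * E x)%R).
    { eapply Rle_trans; [apply at_zero_bound|].
      apply Rle_trans with (c * (/ 2) ^ n)%R; [apply Rmult_le_compat_r; lra|].
      rewrite <- (Rmult_1_r (c * (/ 2) ^ n)) at 1. apply Rmult_le_compat_l; lra. }
    assert (T2 : (Cmod (C_RInt g x0 x) <= M * (2 * c * (/ 2) ^ n) / K * E x)%R).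
    { apply (C_RInt_exp_bound a b); auto. apply Rmult_le_pos; lra. }
    assert (T3 : (M * (2 * c * (/ 2) ^ n) / K * E x <= c * (/ 2) ^ n * E x)%R).
    { apply Rmult_le_compat_r; [lra|]. apply Rle_div_l; [exact HK|].
      replace (M * (2 * c * (/ 2) ^ n))%R with (c * (/ 2) ^ n * (2 * M))%R by ring.
      apply Rmult_le_compat_l; lra. }
    lra. }
  assert (Main : forall n : nat,
    (continuous_on (Icc a b) (A (Z.of_nat n)) /\
     forall x, Icc a b x -> (Cmod (A (Z.of_nat n) x) <= 2 * c * (/ 2) ^ n * E x)%R) /\
    (continuous_on (Icc a b) (B n) /\
     forall x, Icc a b x -> (Cmod (B n x) <= 2 * c * (/ 2) ^ n * E x)%R)).
  { intros n. induction n as [n IH] using lt_wf_ind.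
    assert (HBn : continuous_on (Icc a b) (B n) /\
      forall x, Icc a b x -> (Cmod (B n x) <= 2 * c * (/ 2) ^ n * E x)%R).
    { apply (Step n beta (B n) (fun y => sum_n_m
        (fun k => rho k y * A (Z.of_nat n - Z.of_nat k)%Z y) 1 N) Q); auto.
      - unfold K; lra.
      - apply delayed_sum_continuous; auto. intros j Hj. now apply IH.
      - intros y Hy. assert (HEy := HE y).
        replace (Q * (2 * c * (/ 2) ^ n) * E y)%R with
          (INR N * M2 * 2 ^ N * (2 * c * E y * (/ 2) ^ n))%R by (unfold Q; ring).
        apply (delayed_sum_bound N n (fun k => rho k y) (fun j => A j y)); auto.
        + lra.
        + apply Rmult_le_pos; lra.
        + intros j Hj. replace (2 * c * E y * (/ 2) ^ j)%R
            with (2 * c * (/ 2) ^ j * E y)%R by ring. now apply IH. }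
    split; [|exact HBn].
    apply (Step n alpha (A (Z.of_nat n)) (fun y => P y * B n y) M1); auto; try lra.
    - unfold K; lra.
    - apply continuous_on_mult; [exact HP | apply HBn].
    - intros y Hy. rewrite Cmod_mult, Rmult_assoc.
      apply Rmult_le_compat; try apply Cmod_ge_0; [now apply HPM | now apply HBn]. }
  exists (2 * c * exp (K * (b - a)))%R.
  split; [apply Rmult_le_pos; [lra | apply Rlt_le, exp_pos]|].
  assert (HEb : forall n x, Icc a b x ->
    (2 * c * (/ 2) ^ n * E x <= 2 * c * exp (K * (b - a)) * (/ 2) ^ n)%R).
  { intros n x Hx. assert (Hp := half_pow_pos n).
    assert (HH : (E x <= exp (K * (b - a)))%R).
    { assert (HT : (K * Rabs (x - x0) <= K * (b - a))%R).
      { apply Rmult_le_compat_l; [lra|]. unfold Icc in *. apply Rabs_le. lra. }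
      destruct HT as [HT | HT]; unfold E;
        [apply Rlt_le, exp_increasing, HT | rewrite HT; apply Rle_refl]. }
    replace (2 * c * exp (K * (b - a)) * (/ 2) ^ n)%R with
      (2 * c * (/ 2) ^ n * exp (K * (b - a)))%R by ring.
    apply Rmult_le_compat_l; [apply Rmult_le_pos; lra | exact HH]. }
  intros n. destruct (Main n) as [[CA BA] [CB BB]].
  repeat split; auto; intros x Hx; (eapply Rle_trans; [|apply HEb, Hx]); auto.
Qed.

(** Summing the recursion over [n] turns it into the integral form of the system
    [v' = P * w], [w' = (sum of rho k) * v]. *)
Lemma coupled_series N a b x0 P rho alpha beta A B :
  Icc a b x0 -> continuous_on (Icc a b) P ->
  (forall k, (1 <= k <= N)%nat -> continuous_on (Icc a b) (rho k)) ->
  coupled_recursion N a b x0 P rho alpha beta A B ->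
  let v := fun x => C_Series (fun n => A (Z.of_nat n) x) in
  let w := fun x => C_Series (fun n => B n x) in
  series_cvu_on a b (fun n x => A (Z.of_nat n) x) /\
  v x0 = alpha /\ w x0 = beta /\
  forall x, Icc a b x ->
    is_derive_on a b v x (P x * w x) /\
    is_derive_on a b w x (sum_n_m (fun k => rho k x) 1 N * v x).
Proof.
  intros Hx0 HP Hrho Hrec v w.
  destruct (coupled_bounds N a b x0 P rho alpha beta A B Hx0 HP Hrho Hrec) as [D [HD HAB]].
  destruct Hrec as [HA0 [HA HB]].
  assert (Hab : (a <= b)%R) by (unfold Icc in Hx0; lra).
  assert (SA : forall x, Icc a b x ->
    is_series (V := C_NormedModule) (fun n => A (Z.of_nat n) x) (v x)).
  { intros x Hx. apply (geometric_series _ D HD). intros n. now apply HAB. }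
  assert (SB : forall x, Icc a b x -> is_series (V := C_NormedModule) (fun n => B n x) (w x)).
  { intros x Hx. apply (geometric_series _ D HD). intros n. now apply HAB. }
  (* a dominated series of primitives is a primitive of the sum *)
  assert (Prim : forall (z : C) (F g : nat -> R -> C) (f G : R -> C),
    (forall n, continuous_on (Icc a b) (g n)) ->
    (exists D', (0 <= D')%R /\
      forall n x, Icc a b x -> (Cmod (g n x) <= D' * (/ 2) ^ n)%R) ->
    (forall x, Icc a b x -> is_series (V := C_NormedModule) (fun n => g n x) (G x)) ->
    (forall n x, Icc a b x -> F n x = at_zero z n + C_RInt (g n) x0 x) ->
    (forall x, Icc a b x -> is_series (V := C_NormedModule) (fun n => F n x) (f x)) ->
    f x0 = z /\ forall x, Icc a b x -> is_derive_on a b f x (G x)).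
  { intros z F g f G Hg [D' [HD' Hgb]] HG HF Hf.
    assert (HG' : forall x, Icc a b x -> C_Series (fun n => g n x) = G x).
    { intros x Hx. apply C_Series_unique, HG, Hx. }
    assert (CG : continuous_on (Icc a b) G).
    { apply (continuous_on_equal a b _ G HG').
      now apply continuous_on_C_Series with D'. }
    assert (Ef : forall x, Icc a b x -> f x = z + C_RInt G x0 x).
    { intros x Hx. rewrite <- (C_Series_unique _ _ (Hf x Hx)). apply C_Series_unique.
      apply is_series_ext with (fun n => plus (at_zero z n) (C_RInt (g n) x0 x)).
      - intros n. now rewrite HF.
      - apply (is_series_plus (V := C_NormedModule)); [apply is_series_at_zero|].
        rewrite (C_RInt_equal a b G (fun x => C_Series (fun n => g n x)));
          [ | assumption | assumption | intros; symmetry; now apply HG'].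
        now apply (is_series_C_RInt a b g D'). }
    split.
    - rewrite Ef, C_RInt_point by exact Hx0. ring.
    - now apply (continuous_on_antiderivative a b x0 z f G). }
  destruct (continuous_on_bounded a b P Hab HP) as [M [HM HPM]].
  destruct (Prim alpha (fun n => A (Z.of_nat n)) (fun n y => P y * B n y) v
              (fun x => P x * w x)) as [V0 V1].
  { intros n. apply continuous_on_mult; [exact HP | apply HAB]. }
  { exists (M * D)%R. split; [apply Rmult_le_pos; lra|]. intros n x Hx.
    rewrite Cmod_mult, Rmult_assoc.
    apply Rmult_le_compat; try apply Cmod_ge_0; [now apply HPM | now apply HAB]. }
  { intros x Hx. apply (is_series_scal (V := C_NormedModule) (P x)), SB, Hx. }
  { exact HA. }
  { exact SA. }
  destruct (Prim beta B (fun n y => sum_n_m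
              (fun k => rho k y * A (Z.of_nat n - Z.of_nat k)%Z y) 1 N) w
              (fun x => sum_n_m (fun k => rho k x) 1 N * v x)) as [W0 W1].
  { intros n. apply delayed_sum_continuous; auto. intros j _. apply HAB. }
  { destruct (family_bounded a b N rho Hab Hrho) as [M2 [HM2 HrhoM]].
    exists (INR N * M2 * 2 ^ N * D)%R. split.
    - repeat apply Rmult_le_pos; try lra; [apply pos_INR | apply pow_le; lra].
    - intros n x Hx. rewrite (Rmult_assoc (INR N * M2 * 2 ^ N)).
      apply (delayed_sum_bound N n (fun k => rho k x) (fun j => A j x)); auto; try lra.
      intros j _. now apply HAB. }
  { intros x Hx.
    replace (sum_n_m (fun k => rho k x) 1 N * v x)
      with (sum_n_m (fun k => rho k x * v x) 1 N)
      by apply (sum_n_m_mult_r (K := C_Ring)).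
    apply (is_series_sum_n_m (fun k n => rho k x * A (Z.of_nat n - Z.of_nat k)%Z x)).
    intros k Hk. apply (is_series_scal (V := C_NormedModule) (rho k x)).
    apply (is_series_shift (fun j => A j x)); [|now apply SA].
    intros n Hn. now apply HA0. }
  { exact HB. }
  { exact SB. }
  split; [|split; [exact V0|split; [exact W0|intros x Hx; split; auto]]].
  intros eps. destruct (half_pow_small D eps) as [M' HM']. exists M'. intros n x Hn Hx.
  eapply Rle_lt_trans; [|apply (HM' n Hn)].
  apply (geometric_series (fun k => A (Z.of_nat k) x) D HD). intros m. now apply HAB.
Qed.

(** * The first-order system *)

(** The pair [(v, w)] solves [v' = P * w], [w' = Q * v] on [a, b]. *)
Definition system_solution (a b : R) (P Q v w : R -> C) : Prop :=
  forall x, Icc a b x ->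
    is_derive_on a b v x (P x * w x) /\ is_derive_on a b w x (Q x * v x).

Lemma wronskian_constant (a b : R) (P Q v1 w1 v2 w2 : R -> C) : (a < b)%R ->
  system_solution a b P Q v1 w1 -> system_solution a b P Q v2 w2 ->
  forall x y, Icc a b x -> Icc a b y ->
    v1 x * w2 x - v2 x * w1 x = v1 y * w2 y - v2 y * w1 y.
Proof.
  intros Hab H1 H2.
  apply (is_derive_on_zero_const a b (fun x => v1 x * w2 x - v2 x * w1 x) Hab).
  intros x Hx. destruct (H1 x Hx) as [D1 E1], (H2 x Hx) as [D2 E2].
  apply (is_derive_on_equal a b (fun x => v1 x * w2 x - v2 x * w1 x) _ x
    ((P x * w1 x * w2 x + v1 x * (Q x * v2 x)) - (P x * w2 x * w1 x + v2 x * (Q x * v1 x))));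
    [exact Hx | reflexivity | ring |].
  apply is_derive_on_minus; [exact Hx | |]; now apply is_derive_on_mult.
Qed.

(** Uniqueness without any estimate: the Wronskian of the two reference solutions is
    1, so Cramer's rule expresses [v x] through the Wronskians of [(v, w)] with them,
    and these are constant. *)
Lemma system_general_solution (a b x0 : R) (P Q v1 w1 v2 w2 v w : R -> C) :
  (a < b)%R -> Icc a b x0 ->
  system_solution a b P Q v1 w1 -> v1 x0 = 1 -> w1 x0 = 0 ->
  system_solution a b P Q v2 w2 -> v2 x0 = 0 -> w2 x0 = 1 ->
  system_solution a b P Q v w ->
  forall x, Icc a b x -> v x = v x0 * v1 x + w x0 * v2 x.
Proof.
  intros Hab Hx0 H1 V1 W1 H2 V2 W2 H x Hx.
  assert (I12 := wronskian_constant a b P Q v1 w1 v2 w2 Hab H1 H2 x x0 Hx Hx0).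
  assert (I1 := wronskian_constant a b P Q v w v2 w2 Hab H H2 x x0 Hx Hx0).
  assert (I2 := wronskian_constant a b P Q v1 w1 v w Hab H1 H x x0 Hx Hx0).
  rewrite V1, W1, V2, W2 in I12. rewrite V2, W2 in I1. rewrite V1, W1 in I2.
  assert (E12 : v1 x * w2 x - v2 x * w1 x = 1) by (rewrite I12; ring).
  assert (E1 : v x0 = v x * w2 x - v2 x * w x) by (rewrite I1; ring).
  assert (E2 : w x0 = v1 x * w x - v x * w1 x) by (rewrite I2; ring).
  rewrite E1, E2.
  transitivity (v x * (v1 x * w2 x - v2 x * w1 x)); [rewrite E12|]; ring.
Qed.

Lemma system_linear_combination (a b : R) (P Q v1 w1 v2 w2 : R -> C) (c1 c2 : C) :
  system_solution a b P Q v1 w1 -> system_solution a b P Q v2 w2 ->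
  system_solution a b P Q (fun x => c1 * v1 x + c2 * v2 x) (fun x => c1 * w1 x + c2 * w2 x).
Proof.
  assert (Lin : forall f g x l m, Icc a b x -> is_derive_on a b f x l ->
    is_derive_on a b g x m -> is_derive_on a b (fun y => c1 * f y + c2 * g y) x (c1 * l + c2 * m)).
  { intros f g x l m Hx Hf Hg.
    apply (is_derive_on_equal a b (fun y => c1 * f y + c2 * g y) _ x
      ((0 * f x + c1 * l) + (0 * g x + c2 * m))); [exact Hx | reflexivity | ring |].
    apply is_derive_on_plus; [exact Hx | |].
    - apply (is_derive_on_mult a b (fun _ => c1) f); auto. now apply is_derive_on_const.
    - apply (is_derive_on_mult a b (fun _ => c2) g); auto. now apply is_derive_on_const. }
  intros H1 H2 x Hx. destruct (H1 x Hx) as [D1 E1], (H2 x Hx) as [D2 E2]. split.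
  - replace (P x * (c1 * w1 x + c2 * w2 x)) with (c1 * (P x * w1 x) + c2 * (P x * w2 x)) by ring.
    now apply Lin.
  - replace (Q x * (c1 * v1 x + c2 * v2 x)) with (c1 * (Q x * v1 x) + c2 * (Q x * v2 x)) by ring.
    now apply Lin.
Qed.

Lemma system_linearly_independent (a b x0 : R) (P Q v1 w1 v2 w2 : R -> C) :
  (a < b)%R -> Icc a b x0 -> P x0 <> 0 ->
  system_solution a b P Q v1 w1 -> v1 x0 = 1 -> w1 x0 = 0 ->
  system_solution a b P Q v2 w2 -> v2 x0 = 0 -> w2 x0 = 1 ->
  linearly_independent_on a b v1 v2.
Proof.
  intros Hab Hx0 HP H1 V1 W1 H2 V2 W2 c1 c2 E.
  assert (E1 : c1 = 0).
  { rewrite <- (E x0 Hx0), V1, V2. ring. }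
  split; [exact E1|].
  assert (D := proj1 (system_linear_combination a b P Q v1 w1 v2 w2 c1 c2 H1 H2 x0 Hx0)).
  simpl in D. rewrite W1, W2 in D.
  assert (D0 : is_derive_on a b (fun x => c1 * v1 x + c2 * v2 x) x0 0).
  { apply (is_derive_on_equal a b (fun _ => 0) _ x0 0); auto.
    - intros y Hy. now rewrite E.
    - now apply is_derive_on_const. }
  assert (U := is_derive_on_unique a b _ x0 _ _ Hab Hx0 D D0).
  replace c2 with (P x0 * (c1 * 0 + c2 * 1) / P x0) by (field; exact HP).
  rewrite U. field. exact HP.
Qed.

(** The substitution [u = u0 * v]. The companion function is the Wronskian
    [w = u0 * (p * u') - u * (p * u0')], equal to [p * u0 ^ 2 * v']. It uses only the
    quasi-derivatives [p * u'] and [p * u0'], so [p] need not be differentiable. *)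
Lemma sturm_liouville_system (a b : R) (p q u0 Lam u : R -> C) :
  sturm_liouville_eq a b p q u0 (fun _ => 0) ->
  (forall x, Icc a b x -> u0 x <> 0) -> (forall x, Icc a b x -> p x <> 0) ->
  sturm_liouville_eq a b p q u (fun x => u x * Lam x) <->
  exists w : R -> C, system_solution a b (fun x => 1 / (u0 x ^ 2 * p x))
    (fun x => u0 x ^ 2 * Lam x) (fun x => u x / u0 x) w.
Proof.
  intros [du0 [dpdu0 H0]] Hu0 Hp. split.
  - intros [du [dpdu H]].
    exists (fun y => u0 y * (p y * du y) - u y * (p y * du0 y)).
    intros x Hx. destruct (H0 x Hx) as [D0 [E0 F0]], (H x Hx) as [D [E F]].
    assert (Hu := Hu0 x Hx). assert (Hpx := Hp x Hx). split.
    + apply (is_derive_on_equal a b (fun y => u y * / u0 y) _ x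
        (du x * / u0 x + u x * (- du0 x / (u0 x * u0 x)))); [exact Hx | reflexivity | |].
      * simpl. field. auto.
      * apply is_derive_on_mult; [exact Hx | exact D | now apply is_derive_on_inv].
    + apply (is_derive_on_equal a b
        (fun y => u0 y * (p y * du y) - u y * (p y * du0 y)) _ x
        ((du0 x * (p x * du x) + u0 x * dpdu x) - (du x * (p x * du0 x) + u x * dpdu0 x)));
        [exact Hx | reflexivity | |].
      * replace (dpdu x) with (u x * Lam x - q x * u x) by (rewrite <- F; ring).
        replace (dpdu0 x) with (0 - q x * u0 x) by (rewrite <- F0; ring).
        simpl. field. exact Hu.
      * apply is_derive_on_minus; [exact Hx | |].
        -- now apply (is_derive_on_mult a b u0 (fun y => p y * du y)).
        -- now apply (is_derive_on_mult a b u (fun y => p y * du0 y)).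
  - intros [w Hw].
    (* solving for [u'] gives [p * u' = p * u0' * v + w / u0] *)
    exists (fun x => du0 x * (u x / u0 x) + w x / (u0 x * p x)).
    exists (fun x => u x * Lam x - q x * u x).
    intros x Hx. destruct (H0 x Hx) as [D0 [E0 F0]], (Hw x Hx) as [V W].
    assert (Hu := Hu0 x Hx). assert (Hpx := Hp x Hx). split; [|split; [|ring]].
    + apply (is_derive_on_equal a b (fun y => u0 y * (u y / u0 y)) _ x
        (du0 x * (u x / u0 x) + u0 x * (1 / (u0 x ^ 2 * p x) * w x))); [exact Hx | | |].
      * intros y Hy. assert (Huy := Hu0 y Hy). field. exact Huy.
      * simpl. field. auto.
      * now apply (is_derive_on_mult a b u0 (fun y => u y / u0 y)).
    + apply (is_derive_on_equal a b
        (fun y => (p y * du0 y) * (u y / u0 y) + w y * / u0 y) _ x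
        ((dpdu0 x * (u x / u0 x) + (p x * du0 x) * (1 / (u0 x ^ 2 * p x) * w x))
         + (u0 x ^ 2 * Lam x * (u x / u0 x) * / u0 x + w x * (- du0 x / (u0 x * u0 x)))));
        [exact Hx | | |].
      * intros y Hy. assert (Huy := Hu0 y Hy). assert (Hpy := Hp y Hy). field. auto.
      * replace (dpdu0 x) with (0 - q x * u0 x) by (rewrite <- F0; ring).
        simpl. field. auto.
      * apply is_derive_on_plus; [exact Hx | |].
        -- now apply (is_derive_on_mult a b (fun y => p y * du0 y) (fun y => u y / u0 y)).
        -- apply is_derive_on_mult; [exact Hx | exact W | now apply is_derive_on_inv].
Qed.

(** * Powers of the spectral parameter and formal powers *)

Lemma sum_n_m_Cmult_l (c : C) (s : nat -> C) (n m : nat) :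
  c * sum_n_m s n m = sum_n_m (fun k => c * s k) n m.
Proof. symmetry. apply (sum_n_m_mult_l (K := C_Ring)). Qed.

Lemma sum_n_m_C_ext (s t : nat -> C) (n m : nat) :
  (forall k, (n <= k <= m)%nat -> s k = t k) -> sum_n_m s n m = sum_n_m t n m :> C.
Proof. apply sum_n_m_ext_loc. Qed.

Lemma C_RInt_mult_l (a b : R) (c : C) (f : R -> C) (x y : R) :
  (a < b)%R -> Icc a b x -> Icc a b y ->
  continuous_on (Icc a b) f -> C_RInt (fun t => c * f t) x y = c * C_RInt f x y.
Proof.
  intros Hab Hx Hy Hf.
  assert (Hcf : continuous_on (Icc a b) (fun t => c * f t))
    by (apply continuous_on_mult; [apply continuous_on_const | exact Hf]).
  (* both sides are primitives of the same function *)
  assert (H : C_RInt (fun t => c * f t) x y - c * C_RInt f x y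
            = C_RInt (fun t => c * f t) x x - c * C_RInt f x x).
  { apply (is_derive_on_zero_const a b
      (fun z => C_RInt (fun t => c * f t) x z - c * C_RInt f x z) Hab); [|exact Hy|exact Hx].
    intros z Hz.
    apply (is_derive_on_equal a b
      (fun z => C_RInt (fun t => c * f t) x z - c * C_RInt f x z) _ z
      (c * f z - (0 * C_RInt f x z + c * f z))); [exact Hz | reflexivity | ring |].
    apply is_derive_on_minus; [exact Hz | |].
    - now apply (is_derive_on_C_RInt a b (fun t => c * f t)).
    - apply (is_derive_on_mult a b (fun _ => c)); [exact Hz | |].
      + now apply is_derive_on_const.
      + now apply is_derive_on_C_RInt. }
  rewrite !C_RInt_point in H.
  replace (C_RInt (fun t => c * f t) x y) with
    (C_RInt (fun t => c * f t) x y - c * C_RInt f x y + c * C_RInt f x y) by ring.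
  rewrite H. ring.
Qed.

(** The powers of [lambda] are absorbed by scaling [A n] and [B n] by [lambda ^ n] and
    [rho k] by [lambda ^ k]. The integral is a total function, known to commute
    with scalars only on integrable functions, hence the use of the continuity given by [coupled_bounds]. *)
Lemma coupled_recursion_scale N a b x0 P rho alpha beta A B (lambda : C) :
  (a < b)%R -> Icc a b x0 -> continuous_on (Icc a b) P ->
  (forall k, (1 <= k <= N)%nat -> continuous_on (Icc a b) (rho k)) ->
  coupled_recursion N a b x0 P rho alpha beta A B ->
  coupled_recursion N a b x0 P (fun k x => lambda ^ k * rho k x) alpha beta
    (fun n x => lambda ^ Z.to_nat n * A n x) (fun n x => lambda ^ n * B n x).
Proof.
  intros Hab Hx0 HP Hrho Hrec.
  destruct (coupled_bounds N a b x0 P rho alpha beta A B Hx0 HP Hrho Hrec) as [D [_ HAB]].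
  destruct Hrec as [HA0 [HA HB]].
  assert (Hz : forall c n, lambda ^ n * at_zero c n = at_zero c n)
    by (intros c [|n]; simpl; ring).
  split; [|split].
  - intros n x Hn Hx. rewrite HA0 by assumption. ring.
  - intros n x Hx. rewrite Nat2Z.id, HA by exact Hx.
    rewrite Cmult_plus_distr_l, Hz. f_equal.
    rewrite <- (C_RInt_mult_l a b); auto.
    2:{ apply continuous_on_mult; [exact HP | apply HAB]. }
    apply (C_RInt_equal a b); auto. intros t _. ring.
  - intros n x Hx. rewrite HB by exact Hx.
    rewrite Cmult_plus_distr_l, Hz. f_equal.
    rewrite <- (C_RInt_mult_l a b); auto.
    2:{ apply delayed_sum_continuous; auto. intros j _. apply HAB. }
    apply (C_RInt_equal a b); auto. intros t Ht.
    rewrite sum_n_m_Cmult_l. apply sum_n_m_C_ext. intros k Hk.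
    destruct (le_lt_dec k n) as [Hkn|Hkn].
    + replace (Z.to_nat (Z.of_nat n - Z.of_nat k)) with (n - k)%nat by lia.
      replace (lambda ^ n) with (lambda ^ k * lambda ^ (n - k)).
      * ring.
      * rewrite <- Cpow_add_r. f_equal. lia.
    + rewrite HA0 by (auto; lia). ring.
Qed.

(** For the original recursion, the power series in [lambda] with coefficients [A n]
    converges uniformly and is the first component of a solution of the system. *)
Lemma scaled_solution N a b x0 P rho alpha beta A B (lambda : C) :
  (a < b)%R -> Icc a b x0 -> continuous_on (Icc a b) P ->
  (forall k, (1 <= k <= N)%nat -> continuous_on (Icc a b) (rho k)) ->
  coupled_recursion N a b x0 P rho alpha beta A B ->
  let v := fun x => C_Series (fun n => lambda ^ n * A (Z.of_nat n) x) in
  series_cvu_on a b (fun n x => lambda ^ n * A (Z.of_nat n) x) /\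
  exists w : R -> C, v x0 = alpha /\ w x0 = beta /\
    system_solution a b P (fun x => sum_n_m (fun k => lambda ^ k * rho k x) 1 N) v w.
Proof.
  intros Hab Hx0 HP Hrho Hrec v.
  assert (Hrho' : forall k, (1 <= k <= N)%nat ->
    continuous_on (Icc a b) (fun x => lambda ^ k * rho k x)).
  { intros k Hk. apply continuous_on_mult; [apply continuous_on_const | now apply Hrho]. }
  destruct (coupled_series N a b x0 P _ alpha beta _ _ Hx0 HP Hrho'
    (coupled_recursion_scale N a b x0 P rho alpha beta A B lambda Hab Hx0 HP Hrho Hrec))
    as [U [V0 [W0 S]]].
  assert (E : forall x, C_Series (fun n => lambda ^ Z.to_nat (Z.of_nat n) * A (Z.of_nat n) x) = v x).
  { intros x. unfold v. f_equal. apply functional_extensionality. intros n.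
    now rewrite Nat2Z.id. }
  split.
  - intros eps. destruct (U eps) as [M HM]. exists M. intros n x Hn Hx.
    specialize (HM n x Hn Hx). rewrite E in HM.
    rewrite (sum_n_ext _ (fun k => lambda ^ k * A (Z.of_nat k) x)) in HM; [exact HM|].
    intros k. now rewrite Nat2Z.id.
  - exists (fun x => C_Series (fun n => lambda ^ n * B n x)).
    split; [now rewrite <- E|]. split; [exact W0|].
    intros x Hx. destruct (S x Hx) as [S1 S2]. rewrite E in S2. split; [|exact S2].
    apply (is_derive_on_equal a b _ v x _ _ Hx (fun y _ => E y) eq_refl S1).
Qed.

Lemma C_RInt_zero (a b : R) (f : R -> C) (x y : R) : Icc a b x -> Icc a b y ->
  (forall t, Icc a b t -> f t = 0) -> C_RInt f x y = 0.
Proof.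
  intros Hx Hy E. rewrite (C_RInt_equal a b f (fun _ => 0) x y Hx Hy E).
  rewrite (C_RInt_unique _ x y (scal (V := C_R_NormedModule) (y - x)%R (RtoC 0)))
    by apply (is_RInt_const (V := C_R_NormedModule)).
  rewrite scal_R_Cmult. ring.
Qed.

Lemma sum_n_m_C_zero (s : nat -> C) (n m : nat) :
  (forall k, (n <= k <= m)%nat -> s k = 0) -> sum_n_m s n m = 0 :> C.
Proof.
  intros H. rewrite (sum_n_m_C_ext s (fun _ => 0 * 0)).
  - rewrite <- sum_n_m_Cmult_l. ring.
  - intros k Hk. rewrite H by exact Hk. ring.
Qed.

(** Here [A n] is [Xt (2 * n)] and [B n] is [Xt (2 * n - 1)]. At [n = 0] the second
    one is [Xt (- 1)], which vanishes, as does its integrand in the recursion. *)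
Lemma formal_powers_recursion_Xt N a b p r u0 x0 Xt X : Icc a b x0 ->
  formal_powers N a b p r u0 x0 Xt X ->
  coupled_recursion N a b x0 (fun x => 1 / (u0 x ^ 2 * p x)) (fun k x => u0 x ^ 2 * r k x) 1 0
    (fun n => Xt (2 * n)%Z) (fun n => Xt (2 * Z.of_nat n - 1)%Z).
Proof.
  intros Hx0 [Hneg _ H0 _ Hodd Heven _ _]. split; [|split].
  - intros n x Hn Hx. apply Hneg; [lia | exact Hx].
  - intros [|n] x Hx; cbn [at_zero].
    + rewrite (H0 x Hx : Xt (2 * Z.of_nat 0)%Z x = 1).
      rewrite (C_RInt_zero a b); auto; [ring|].
      intros t Ht. rewrite Hneg by (auto; lia). ring.
    + rewrite Heven; [ | lia | exists (Z.of_nat (S n)); lia | exact Hx].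
      rewrite Cplus_0_l. apply (C_RInt_equal a b); auto. intros t _. ring.
  - intros [|n] x Hx; cbn [at_zero].
    + rewrite Hneg by (auto; lia). rewrite (C_RInt_zero a b); auto; [ring|].
      intros t Ht. apply sum_n_m_C_zero. intros k Hk.
      rewrite Hneg by (auto; lia). ring.
    + rewrite Hodd; [ | lia | exists (Z.of_nat n); lia | exact Hx].
      rewrite Cplus_0_l. apply (C_RInt_equal a b); auto. intros t _.
      rewrite sum_n_m_Cmult_l. apply sum_n_m_C_ext. intros k _.
      replace (2 * Z.of_nat (S n) - 1 - 2 * Z.of_nat k + 1)%Z
        with (2 * (Z.of_nat (S n) - Z.of_nat k))%Z by lia. ring.
Qed.

(** Here [A n] is [X (2 * n + 1)] and [B n] is [X (2 * n)], so the initial value 1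
    sits on the second component. *)
Lemma formal_powers_recursion_X N a b p r u0 x0 Xt X : Icc a b x0 ->
  formal_powers N a b p r u0 x0 Xt X ->
  coupled_recursion N a b x0 (fun x => 1 / (u0 x ^ 2 * p x)) (fun k x => u0 x ^ 2 * r k x) 0 1
    (fun n => X (2 * n + 1)%Z) (fun n => X (2 * Z.of_nat n)%Z).
Proof.
  intros Hx0 [_ Hneg _ H0 _ _ Hodd Heven]. split; [|split].
  - intros n x Hn Hx. apply Hneg; [lia | exact Hx].
  - intros n x Hx.
    rewrite Hodd; [ | lia | exists (Z.of_nat n); lia | exact Hx].
    replace (at_zero 0 n) with (RtoC 0) by now destruct n.
    rewrite Cplus_0_l. apply (C_RInt_equal a b); auto. intros t _.
    replace (2 * Z.of_nat n + 1 - 1)%Z with (2 * Z.of_nat n)%Z by lia. ring.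
  - intros [|n] x Hx; cbn [at_zero].
    + rewrite (H0 x Hx : X (2 * Z.of_nat 0)%Z x = 1).
      rewrite (C_RInt_zero a b); auto; [ring|].
      intros t Ht. apply sum_n_m_C_zero. intros k Hk.
      rewrite Hneg by (auto; lia). ring.
    + rewrite Heven; [ | lia | exists (Z.of_nat (S n)); lia | exact Hx].
      rewrite Cplus_0_l. apply (C_RInt_equal a b); auto. intros t _.
      rewrite sum_n_m_Cmult_l. apply sum_n_m_C_ext. intros k _.
      replace (2 * Z.of_nat (S n) - 2 * Z.of_nat k + 1)%Z
        with (2 * (Z.of_nat (S n) - Z.of_nat k) + 1)%Z by lia. ring.
Qed.

Theorem theorem2p1 (N : nat) (HN : (1 <= N)%nat) (a b : R) (Hab : (a < b)%R)
  (p q : R -> C) (r : nat -> R -> C) (lambda : C) (u0 : R -> C)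
  (Hu0 : sturm_liouville_eq a b p q u0 (fun _ => 0))
  (Hu0_nz : forall x, Icc a b x -> u0 x <> 0)
  (Hr : forall k, (1 <= k <= N)%nat ->
     continuous_on (Icc a b) (fun x => u0 x ^ 2 * r k x))
  (* [1 / (u0 ^ 2 * p)] is defined on all of [a, b]; division in [C] is total *)
  (Hp_nz : forall x, Icc a b x -> p x <> 0)
  (Hp : continuous_on (Icc a b) (fun x => 1 / (u0 x ^ 2 * p x)))
  (x0 : R) (Hx0 : Icc a b x0) (Hpx0 : p x0 <> 0)
  (Xt X : Z -> R -> C) (HX : formal_powers N a b p r u0 x0 Xt X) :
  series_cvu_on a b (fun n x => lambda ^ n * Xt (2 * Z.of_nat n)%Z x) /\
  series_cvu_on a b (fun n x => lambda ^ n * X (2 * Z.of_nat n + 1)%Z x) /\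
  general_solution_on a b (pencil_solution N a b p q r lambda)
    (fun x => u0 x *
       C_Series (fun n => lambda ^ n * Xt (2 * Z.of_nat n)%Z x))
    (fun x => u0 x *
       C_Series (fun n => lambda ^ n * X (2 * Z.of_nat n + 1)%Z x)).
Proof.
  destruct (scaled_solution N a b x0 _ _ 1 0 _ _ lambda Hab Hx0 Hp Hr
    (formal_powers_recursion_Xt N a b p r u0 x0 Xt X Hx0 HX)) as [U1 [w1 [V10 [W10 S1]]]].
  destruct (scaled_solution N a b x0 _ _ 0 1 _ _ lambda Hab Hx0 Hp Hr
    (formal_powers_recursion_X N a b p r u0 x0 Xt X Hx0 HX)) as [U2 [w2 [V20 [W20 S2]]]].
  split; [exact U1 | split; [exact U2|]]. clear U1 U2.
  set (v1 := fun x => C_Series (fun n => lambda ^ n * Xt (2 * Z.of_nat n)%Z x)) in *.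
  set (v2 := fun x => C_Series (fun n => lambda ^ n * X (2 * Z.of_nat n + 1)%Z x)) in *.
  set (P := fun x => 1 / (u0 x ^ 2 * p x)) in *.
  set (Q := fun x => sum_n_m (fun k => lambda ^ k * (u0 x ^ 2 * r k x)) 1 N) in *.
  assert (EQ : forall x, Q x = u0 x ^ 2 * pencil N lambda r x).
  { intros x. unfold Q, pencil. rewrite sum_n_m_Cmult_l.
    apply sum_n_m_C_ext. intros k _. ring. }
  assert (Sol : forall u, pencil_solution N a b p q r lambda u <->
    exists w, system_solution a b P Q (fun x => u x / u0 x) w).
  { intros u. unfold pencil_solution.
    rewrite (sturm_liouville_system a b p q u0 (pencil N lambda r) u Hu0 Hu0_nz Hp_nz).
    split; intros [w Hw]; exists w; intros x Hx; destruct (Hw x Hx) as [D E]; split;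
      try exact D; [rewrite EQ | rewrite <- EQ]; exact E. }
  assert (Back : forall u c1 c2,
    (forall x, Icc a b x -> u x = c1 * (u0 x * v1 x) + c2 * (u0 x * v2 x)) ->
    pencil_solution N a b p q r lambda u).
  { intros u c1 c2 Hu. apply Sol. exists (fun x => c1 * w1 x + c2 * w2 x).
    assert (Hv : forall x, Icc a b x -> c1 * v1 x + c2 * v2 x = u x / u0 x).
    { intros x Hx. assert (H := Hu0_nz x Hx). rewrite Hu by exact Hx. field. exact H. }
    intros x Hx.
    destruct (system_linear_combination a b P Q v1 w1 v2 w2 c1 c2 S1 S2 x Hx) as [D E].
    rewrite Hv in E by exact Hx. split; [|exact E].
    exact (is_derive_on_equal a b _ _ x _ _ Hx Hv eq_refl D). }
  assert (HPx0 : P x0 <> 0).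
  { unfold P. intros H. apply C1_nz.
    replace (RtoC 1) with (1 / (u0 x0 ^ 2 * p x0) * (u0 x0 ^ 2 * p x0)).
    - rewrite H. ring.
    - simpl. assert (H' := Hu0_nz x0 Hx0). field. auto. }
  change (general_solution_on a b (pencil_solution N a b p q r lambda)
    (fun x => u0 x * v1 x) (fun x => u0 x * v2 x)).
  split; [|split; [|split]].
  - apply (Back _ 1 0). intros x _. ring.
  - apply (Back _ 0 1). intros x _. ring.
  - intros c1 c2 E.
    apply (system_linearly_independent a b x0 P Q v1 w1 v2 w2); auto.
    intros x Hx. assert (H := Hu0_nz x Hx).
    replace (c1 * v1 x + c2 * v2 x) with
      ((c1 * (u0 x * v1 x) + c2 * (u0 x * v2 x)) / u0 x) by (field; exact H).
    rewrite E by exact Hx. field. exact H.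
  - intros u. split.
    + intros Hu. apply Sol in Hu. destruct Hu as [w Hw].
      exists (u x0 / u0 x0), (w x0). intros x Hx. assert (H := Hu0_nz x Hx).
      assert (G := system_general_solution a b x0 P Q v1 w1 v2 w2 _ w Hab Hx0
                     S1 V10 W10 S2 V20 W20 Hw x Hx).
      replace (u x) with (u0 x * (u x / u0 x)) by (field; exact H).
      simpl in G. rewrite G. ring.
    + intros [c1 [c2 Hu]]. exact (Back u c1 c2 Hu).
Qed.
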